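(* The system $\mathsf{ACA}_0^\omega+\Delta\text{-}\mathsf{CA}$ proves the implication $\mathsf{MCT}_{\mathsf{net}}^{[0,1]}\rightarrow \mathsf{BOOT}$, where $\mathsf{MCT}_{\mathsf{net}}^{[0,1]}$ is the statement: any increasing net in $[0,1]$ indexed by $\mathbb{N}^{\mathbb{N}}$ converges; and $\mathsf{BOOT}$ is the statement $$(\forall Y^{2})(\exists X^{1})(\forall n^{0})\big[ n\in X \leftrightarrow (\exists f^{1})(Y(f, n)=0)\big].$$
   Context: Finite types: $0$ is a type (natural numbers), and if $\sigma,\tau$ are types, so is $\sigma\to\tau$ (mappings from type $\sigma$ to type $\tau$ objects); $1\equiv 0\to 0$ and $n+1\equiv n\to 0$. Superscripts indicate types. Type $1$ objects are elements of $\mathbb{N}^{\mathbb{N}}$, type $2$ objects are functionals $\mathbb{N}^{\mathbb{N}}\to\mathbb{N}$. $\rho^{*}$ is the type of finite sequences of type $\rho$ objects; finite sequences of type $1$ objects are coded as type $1$ objects, and pairs are coded as usual. $\mathsf{L}_\omega$ is the language with variables of every finite type, constants $0,1,<_0,+_0,\times_0,=_0$, the combinators $\Pi,\Sigma$ and the recursor $\mathbf{R}_0$. For $\tau=(\tau_1\to\dots\to\tau_k\to 0)$, $x=_\tau y$ means $(\forall z_1^{\tau_1}\dots z_k^{\tau_k})(xz_1\dots z_k=_0 yz_1\dots z_k)$. The system $\mathsf{RCA}_0^\omega$ has the axioms: (a) $0,1,<_0,+_0,\times_0$ form an ordered semi-ring with equality $=_0$; (b) the defining axioms of the combinators $\Pi,\Sigma$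 (giving $\lambda$-abstraction); (c) $\mathbf{R}_0(f^1,m^0,0)=m$ and $\mathbf{R}_0(f,m,n+1)=f(n,\mathbf{R}_0(f,m,n))$; (d) extensionality: $(\forall x^\rho,y^\rho,\varphi^{\rho\to\tau})(x=_\rho y\to\varphi(x)=_\tau\varphi(y))$ for all types $\rho,\tau$; (e) induction for quantifier-free formulas of $\mathsf{L}_\omega$; (f) $\mathsf{QF}\text{-}\mathsf{AC}^{1,0}$, where $\mathsf{QF}\text{-}\mathsf{AC}^{\sigma,\tau}$ is $(\forall x^\sigma)(\exists y^\tau)A(x,y)\to(\exists Y^{\sigma\to\tau})(\forall x^\sigma)A(x,Y(x))$ for quantifier-free $A$ of $\mathsf{L}_\omega$. $\mathsf{ACA}_0^\omega$ is $\mathsf{RCA}_0^\omega+(\mu^2)$, where $(\mu^2)$ is $(\exists\mu^2)(\forall f^1)\big[(\exists n)(f(n)=0)\to[f(\mu(f))=0\wedge(\forall i<\mu(f))f(i)\neq0]\wedge[(\forall n)(f(n)\neq 0)\to\mu(f)=0]\big]$. $\Delta\text{-}\mathsf{CA}$ is: $(\forall Y^2,Z^2)\big[(\forall n^0)\big((\exists f^1)(Y(f,n)=0)\leftrightarrow(\forall g^1)(Z(g,n)=0)\big)\to(\exists X^1)(\forall n^0)(n\in X\leftrightarrow(\exists f^1)(Y(f,n)=0))\big]$. Sets are given by characteristic functions: $X\subseteq\mathbb{N}$ is a type $1$ object; $D\subseteq\mathbb{N}^{\mathbb{N}}$ is given by some $F_D^2\leq 1$, with $f\in D$ meaning $F_D(f)=1$;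 a binary relation $\preceq$ on $D$ is given by some $G_\preceq^{(1\times1)\to0}$, with $f\preceq g$ meaning $G_\preceq(f,g)=1$. Real numbers are represented by fast-converging Cauchy sequences of rationals $q_{(\cdot)}$, i.e. $|q_n-q_{n+i}|<2^{-n}$ for all $n,i$. A set $D\neq\emptyset$ with a binary relation $\preceq$ is directed if $\preceq$ is transitive and reflexive on $D$ and for all $x,y\in D$ there is $z\in D$ with $x\preceq z\wedge y\preceq z$. A net in a space is a mapping $x_d$ from such a directed set $(D,\preceq)$ into it. A net ''indexed by $\mathbb{N}^{\mathbb{N}}$'' is one whose directed set $D$ is a subset of $\mathbb{N}^{\mathbb{N}}$ (with any relation $\preceq$ making it directed). A net $x_d:D\to\mathbb{R}$ is increasing if $a\preceq b$ implies $x_a\leq_{\mathbb{R}}x_b$ for all $a,b\in D$. A net $x_d$ converges to $y$ if for every neighbourhood $U$ of $y$ there is $d_0\in D$ such that $x_e\in U$ for all $e\succeq d_0$. *)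

(* Defs.v *)
From Stdlib Require Import List.
Import ListNotations.

Set Implicit Arguments.
Unset Strict Implicit.
Unset Printing Implicit Defensive.

Inductive ty : Type :=
| N0 : ty
| Arr : ty -> ty -> ty.

Declare Scope ty_scope.
Delimit Scope ty_scope with ty.
Bind Scope ty_scope with ty.
Notation "s ⇒ t" := (Arr s t) (at level 55, right associativity) : ty_scope.
Notation N1 := (Arr N0 N0).
Notation N2 := (Arr N1 N0).

(** Syntax is intrinsically typed with de Bruijn variables: a context lists
    the types of the free variables, the innermost one first. *)
Definition ctx : Type := list ty.

Inductive var : ctx -> ty -> Type :=
| V0 : forall G s, var (s :: G) s
| VS : forall G s t, var G t -> var (s :: G) t.
Arguments V0 {G s}.
Arguments VS {G s t} _.

(** [cRec] takes its step function in curried form, of type [0 ⇒ 0 ⇒ 0]. *)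
Inductive tm (G : ctx) : ty -> Type :=
| tVar : forall t, var G t -> tm G t
| tApp : forall s t, tm G (Arr s t) -> tm G s -> tm G t
| cZero : tm G N0
| cOne : tm G N0
| cAdd : tm G (Arr N0 (Arr N0 N0))
| cMul : tm G (Arr N0 (Arr N0 N0))
| cPi : forall s t, tm G (Arr s (Arr t s))
| cSigma : forall r s t,
    tm G (Arr (Arr r (Arr s t)) (Arr (Arr r s) (Arr r t)))
| cRec : tm G (Arr (Arr N0 (Arr N0 N0)) (Arr N0 (Arr N0 N0))).
Arguments tVar {G t} _.
Arguments tApp {G s t} _ _.
Arguments cZero {G}.
Arguments cOne {G}.
Arguments cAdd {G}.
Arguments cMul {G}.
Arguments cPi {G} s t.
Arguments cSigma {G} r s t.
Arguments cRec {G}.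

Inductive fm : ctx -> Type :=
| fBot : forall G, fm G
| fEq : forall G, tm G N0 -> tm G N0 -> fm G
| fLt : forall G, tm G N0 -> tm G N0 -> fm G
| fImp : forall G, fm G -> fm G -> fm G
| fAnd : forall G, fm G -> fm G -> fm G
| fOr : forall G, fm G -> fm G -> fm G
| fAll : forall G s, fm (s :: G) -> fm G
| fEx : forall G s, fm (s :: G) -> fm G.
Arguments fBot {G}.

Fixpoint qf {G} (A : fm G) : Prop :=
  match A with
  | fBot | fEq _ _ | fLt _ _ => True
  | fImp A B | fAnd A B | fOr A B => qf A /\ qf B
  | fAll _ | fEx _ => False
  end.

Definition ren (G D : ctx) : Type := forall t, var G t -> var D t.
Definition sub (G D : ctx) : Type := forall t, var G t -> tm D t.

Definition ren_up {G D s} (r : ren G D) : ren (s :: G) (s :: D) :=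
  fun t v =>
    match v in var L t
      return match L with
             | [] => unit
             | s :: G => ren G D -> var (s :: D) t
             end
    with
    | V0 => fun _ => V0
    | VS w => fun r => VS (r _ w)
    end r.

Fixpoint tren {G D} (r : ren G D) {t} (u : tm G t) : tm D t :=
  match u with
  | tVar v => tVar (r _ v)
  | tApp a b => tApp (tren r a) (tren r b)
  | cZero => cZero
  | cOne => cOne
  | cAdd => cAdd
  | cMul => cMul
  | cPi s t => cPi s t
  | cSigma r s t => cSigma r s t
  | cRec => cRec
  end.

Fixpoint fren {G} (A : fm G) : forall {D}, ren G D -> fm D :=
  match A with
  | fBot => fun _ _ => fBot
  | fEq a b => fun _ r => fEq (tren r a) (tren r b)
  | fLt a b => fun _ r => fLt (tren r a) (tren r b)
  | fImp A B => fun _ r => fImp (fren A r) (fren B r)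
  | fAnd A B => fun _ r => fAnd (fren A r) (fren B r)
  | fOr A B => fun _ r => fOr (fren A r) (fren B r)
  | fAll A => fun _ r => fAll (fren A (ren_up r))
  | fEx A => fun _ r => fEx (fren A (ren_up r))
  end.

Definition shift {G s} : ren G (s :: G) := fun t v => VS v.

Definition sub_id {G} : sub G G := fun t v => tVar v.

Definition sub_cons {G D s} (u : tm D s) (f : sub G D) : sub (s :: G) D :=
  fun t v =>
    match v in var L t
      return match L with
             | [] => unit
             | s :: G => tm D s -> sub G D -> tm D t
             end
    with
    | V0 => fun u _ => u
    | VS w => fun _ f => f _ w
    end u f.

Definition sub_up {G D s} (f : sub G D) : sub (s :: G) (s :: D) :=
  sub_cons (tVar V0) (fun t v => tren shift (f t v)).

Fixpoint tsub {G D} (f : sub G D) {t} (u : tm G t) : tm D t :=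
  match u with
  | tVar v => f _ v
  | tApp a b => tApp (tsub f a) (tsub f b)
  | cZero => cZero
  | cOne => cOne
  | cAdd => cAdd
  | cMul => cMul
  | cPi s t => cPi s t
  | cSigma r s t => cSigma r s t
  | cRec => cRec
  end.

Fixpoint fsub {G} (A : fm G) : forall {D}, sub G D -> fm D :=
  match A with
  | fBot => fun _ _ => fBot
  | fEq a b => fun _ f => fEq (tsub f a) (tsub f b)
  | fLt a b => fun _ f => fLt (tsub f a) (tsub f b)
  | fImp A B => fun _ f => fImp (fsub A f) (fsub B f)
  | fAnd A B => fun _ f => fAnd (fsub A f) (fsub B f)
  | fOr A B => fun _ f => fOr (fsub A f) (fsub B f)
  | fAll A => fun _ f => fAll (fsub A (sub_up f))
  | fEx A => fun _ f => fEx (fsub A (sub_up f))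
  end.

Definition inst {G s} (A : fm (s :: G)) (u : tm G s) : fm G :=
  fsub A (sub_cons u sub_id).

(** A theory gives, for every context, the formulas it takes as axioms; free
    variables of axioms are read universally. *)

Definition theory : Type := forall G : ctx, fm G -> Prop.

Inductive prv (T : theory) : forall G, list (fm G) -> fm G -> Prop :=
| p_ax : forall G (H : list (fm G)) A, T G A -> prv T H A
| p_hyp : forall G (H : list (fm G)) A, In A H -> prv T H A
| p_dne : forall G (H : list (fm G)) A,
    prv T (fImp A fBot :: H) fBot -> prv T H A
| p_imp_i : forall G (H : list (fm G)) A B,
    prv T (A :: H) B -> prv T H (fImp A B)
| p_imp_e : forall G (H : list (fm G)) A B,
    prv T H (fImp A B) -> prv T H A -> prv T H B
| p_and_i : forall G (H : list (fm G)) A B,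
    prv T H A -> prv T H B -> prv T H (fAnd A B)
| p_and_e1 : forall G (H : list (fm G)) A B, prv T H (fAnd A B) -> prv T H A
| p_and_e2 : forall G (H : list (fm G)) A B, prv T H (fAnd A B) -> prv T H B
| p_or_i1 : forall G (H : list (fm G)) A B, prv T H A -> prv T H (fOr A B)
| p_or_i2 : forall G (H : list (fm G)) A B, prv T H B -> prv T H (fOr A B)
| p_or_e : forall G (H : list (fm G)) A B C,
    prv T H (fOr A B) -> prv T (A :: H) C -> prv T (B :: H) C -> prv T H C
| p_all_i : forall G (H : list (fm G)) s (A : fm (s :: G)),
    prv T (map (fun B => fren B shift) H) A -> prv T H (fAll A)
| p_all_e : forall G (H : list (fm G)) s (A : fm (s :: G)) (u : tm G s),
    prv T H (fAll A) -> prv T H (inst A u)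
| p_ex_i : forall G (H : list (fm G)) s (A : fm (s :: G)) (u : tm G s),
    prv T H (inst A u) -> prv T H (fEx A)
| p_ex_e : forall G (H : list (fm G)) s (A : fm (s :: G)) (C : fm G),
    prv T H (fEx A) ->
    prv T (A :: map (fun B => fren B shift) H) (fren C shift) -> prv T H C.

Definition proves (T : theory) (A : fm []) : Prop := prv T [] A.

Definition from_nil {G} : ren [] G :=
  fun t v => match v in var L t return match L with
                                       | [] => var G t
                                       | _ :: _ => unit
                                       end
             with V0 => tt | VS _ => tt end.

Definition add_axiom (T : theory) (A : fm []) : theory :=
  fun G B => T G B \/ B = fren A from_nil.

(** Binders are written with names: the bound name stands for the innermost
    variable of the extended context, and [↑ x] carries a term [x] into the
    context of its occurrence. *)

Class Ext (G D : ctx) : Type := ext : ren G D.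
#[export] Instance ext_refl G : Ext G G := fun t v => v.
#[export] Instance ext_skip G D s (e : Ext G D) : Ext G (s :: D) :=
  fun t v => VS (e t v).

Definition lift {G D} {e : Ext G D} {t} (u : tm G t) : tm D t := tren e u.

Definition all {G} s (F : tm (s :: G) s -> fm (s :: G)) : fm G :=
  fAll (F (tVar V0)).
Definition ex {G} s (F : tm (s :: G) s -> fm (s :: G)) : fm G :=
  fEx (F (tVar V0)).
Arguments all {G} s & F.
Arguments ex {G} s & F.

(** λ-abstraction is defined from the combinators by bracket abstraction. *)
Definition abs_var {G s t} (v : var (s :: G) t) : tm G (Arr s t) :=
  match v in var L t
    return match L with [] => unit | s :: G => tm G (Arr s t) end
  with
  | @V0 _ s => tApp (tApp (cSigma s (Arr s s) s) (cPi s (Arr s s))) (cPi s s)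
  | @VS _ s t w => tApp (cPi t s) (tVar w)
  end.

Fixpoint abs {G s t} (u : tm (s :: G) t) : tm G (Arr s t) :=
  match u with
  | tVar v => abs_var v
  | @tApp _ r t a b => tApp (tApp (cSigma s r t) (abs a)) (abs b)
  | cZero => tApp (cPi _ _) cZero
  | cOne => tApp (cPi _ _) cOne
  | cAdd => tApp (cPi _ _) cAdd
  | cMul => tApp (cPi _ _) cMul
  | cPi r t => tApp (cPi _ _) (cPi r t)
  | cSigma q r t => tApp (cPi _ _) (cSigma q r t)
  | cRec => tApp (cPi _ _) cRec
  end.

Definition lam {G} s {t} (F : tm (s :: G) s -> tm (s :: G) t)
  : tm G (Arr s t) := abs (F (tVar V0)).
Arguments lam {G} s {t} & F.

Declare Scope tm_scope.
Delimit Scope tm_scope with tm.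
Bind Scope tm_scope with tm.
Declare Scope fm_scope.
Delimit Scope fm_scope with fm.
Bind Scope fm_scope with fm.
Local Open Scope ty_scope.
Local Open Scope tm_scope.
Local Open Scope fm_scope.

Notation "↑ x" := (lift x) (at level 8, right associativity, x at level 8)
  : tm_scope.
Notation "f · x" := (tApp f x) (at level 38, left associativity) : tm_scope.
Notation "0" := cZero : tm_scope.
Notation "1" := cOne : tm_scope.
Notation "a + b" := (tApp (tApp cAdd a) b) : tm_scope.
Notation "a * b" := (tApp (tApp cMul a) b) : tm_scope.
Notation "'λ' x : s , u" := (lam s (fun x => u))
  (at level 200, x name, s at level 99, u at level 200) : tm_scope.

Notation "a ≐ b" := (fEq a b) (at level 70, no associativity) : fm_scope.
Notation "a ≺ b" := (fLt a b) (at level 70, no associativity) : fm_scope.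
Notation "a ≼ b" := (fOr (fLt a b) (fEq a b)) (at level 70, no associativity)
  : fm_scope.
Notation "¬ A" := (fImp A fBot) (at level 75, right associativity) : fm_scope.
Notation "A ∧ B" := (fAnd A B) (at level 80, right associativity) : fm_scope.
Notation "A ∨ B" := (fOr A B) (at level 85, right associativity) : fm_scope.
Notation "A ⟶ B" := (fImp A B) (at level 90, right associativity) : fm_scope.
Notation "A ⟷ B" := (fAnd (fImp A B) (fImp B A))
  (at level 95, no associativity) : fm_scope.
Notation "∀ x : s , A" := (all s (fun x => A))
  (at level 200, x name, s at level 99, A at level 200) : fm_scope.
Notation "∃ x : s , A" := (ex s (fun x => A))
  (at level 200, x name, s at level 99, A at level 200) : fm_scope.

Fixpoint eqt {G} t : tm G t -> tm G t -> fm G :=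
  match t with
  | N0 => fun a b => a ≐ b
  | Arr s t => fun a b => ∀ z : s, eqt (↑a · z) (↑b · z)
  end.

Definition inst_zero {G} (A : fm (N0 :: G)) : fm G := inst A 0.
Definition inst_succ {G} (A : fm (N0 :: G)) : fm (N0 :: G) :=
  fsub A (sub_cons (tVar V0 + 1) (fun t v => tVar (VS v))).

(** In [QF_AC A] the variables of [A] are [y] (innermost), then [x]. *)
Definition QF_AC {G} s t (A : fm (t :: s :: G)) : fm G :=
  fAll (fEx A) ⟶
  fEx (fAll (fsub A
    (sub_cons (D := s :: (s ⇒ t) :: G) (tVar (VS V0) · tVar V0)
      (sub_cons (tVar V0) (fun r v => tVar (VS (VS v))))))).

Inductive RCA0w : theory :=
| ax_eq_refl : forall G (a : tm G N0), RCA0w (a ≐ a)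
| ax_eq_sym : forall G (a b : tm G N0), RCA0w (a ≐ b ⟶ b ≐ a)
| ax_eq_trans : forall G (a b c : tm G N0),
    RCA0w (a ≐ b ⟶ b ≐ c ⟶ a ≐ c)
| ax_lt_cong : forall G (a b c d : tm G N0),
    RCA0w (a ≐ b ⟶ c ≐ d ⟶ a ≺ c ⟶ b ≺ d)
| ax_add_assoc : forall G (a b c : tm G N0),
    RCA0w (a + (b + c) ≐ a + b + c)
| ax_add_comm : forall G (a b : tm G N0), RCA0w (a + b ≐ b + a)
| ax_add_0 : forall G (a : tm G N0), RCA0w (a + 0 ≐ a)
| ax_mul_assoc : forall G (a b c : tm G N0),
    RCA0w (a * (b * c) ≐ a * b * c)
| ax_mul_comm : forall G (a b : tm G N0), RCA0w (a * b ≐ b * a)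
| ax_mul_1 : forall G (a : tm G N0), RCA0w (a * 1 ≐ a)
| ax_mul_0 : forall G (a : tm G N0), RCA0w (a * 0 ≐ 0)
| ax_distr : forall G (a b c : tm G N0),
    RCA0w (a * (b + c) ≐ a * b + a * c)
| ax_lt_irrefl : forall G (a : tm G N0), RCA0w (¬ a ≺ a)
| ax_lt_trans : forall G (a b c : tm G N0),
    RCA0w (a ≺ b ⟶ b ≺ c ⟶ a ≺ c)
| ax_lt_total : forall G (a b : tm G N0), RCA0w (a ≺ b ∨ a ≐ b ∨ b ≺ a)
| ax_lt_01 : forall G, RCA0w (G := G) (0 ≺ 1)
| ax_lt_add : forall G (a b c : tm G N0), RCA0w (a ≺ b ⟶ a + c ≺ b + c)
| ax_lt_mul : forall G (a b c : tm G N0),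
    RCA0w (0 ≺ c ⟶ a ≺ b ⟶ a * c ≺ b * c)
| ax_pi : forall G s t (a : tm G s) (b : tm G t),
    RCA0w (eqt (cPi s t · a · b) a)
| ax_sigma : forall G r s t
    (a : tm G (r ⇒ s ⇒ t)) (b : tm G (r ⇒ s)) (c : tm G r),
    RCA0w (eqt (cSigma r s t · a · b · c) (a · c · (b · c)))
| ax_rec_0 : forall G (f : tm G (N0 ⇒ N0 ⇒ N0)) (m : tm G N0),
    RCA0w (cRec · f · m · 0 ≐ m)
| ax_rec_S : forall G (f : tm G (N0 ⇒ N0 ⇒ N0)) (m n : tm G N0),
    RCA0w (cRec · f · m · (n + 1) ≐ f · n · (cRec · f · m · n))
| ax_ext : forall G s t (a b : tm G s) (f : tm G (s ⇒ t)),
    RCA0w (eqt a b ⟶ eqt (f · a) (f · b))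
| ax_ind : forall G (A : fm (N0 :: G)), qf A ->
    RCA0w (inst_zero A ⟶ fAll (A ⟶ inst_succ A) ⟶ fAll A)
| ax_choice : forall G (A : fm (N0 :: N1 :: G)), qf A -> RCA0w (QF_AC A).

Definition mu2 : fm [] :=
  ∃ mu : N2, ∀ f : N1,
    ((∃ n : N0, ↑f · n ≐ 0) ⟶
       f · (↑mu · f) ≐ 0 ∧
       (∀ i : N0, i ≺ ↑mu · ↑f ⟶ ¬ ↑f · i ≐ 0)) ∧
    ((∀ n : N0, ¬ ↑f · n ≐ 0) ⟶ ↑mu · f ≐ 0).

Definition ACA0w : theory := add_axiom RCA0w mu2.

(** The pair of a sequence [f] and a number [n], as the sequence
    [n, f 0, f 1, ...]. *)
Definition pair10 {G} (f : tm G N1) (n : tm G N0) : tm G N1 :=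
  cRec · (λ j : N0, λ r : N0, ↑f · ↑j) · n.

Definition mem0 {G} (n : tm G N0) (X : tm G N1) : fm G := X · n ≐ 1.
Definition mem1 {G} (f : tm G N1) (D : tm G N2) : fm G := D · f ≐ 1.
Definition char1 {G} (D : tm G N2) : fm G := ∀ f : N1, ↑D · f ≼ 1.
Definition rel1 {G} (R : tm G (N1 ⇒ N1 ⇒ N0)) (f g : tm G N1) : fm G :=
  R · f · g ≐ 1.

Definition Delta_CA : fm [] :=
  ∀ Y : N2, ∀ Z : N2,
    (∀ n : N0,
       (∃ f : N1, ↑Y · pair10 f ↑n ≐ 0) ⟷ (∀ g : N1, ↑Z · pair10 g ↑n ≐ 0)) ⟶
    ∃ X : N1, ∀ n : N0, mem0 n ↑X ⟷ (∃ f : N1, ↑Y · pair10 f ↑n ≐ 0).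

Definition BOOT : fm [] :=
  ∀ Y : N2, ∃ X : N1, ∀ n : N0,
    mem0 n ↑X ⟷ (∃ f : N1, ↑Y · pair10 f ↑n ≐ 0).

(** [Frac a b c] is the metalevel fraction [(a - b) / c], for [c > 0]. *)
Record frac (G : ctx) : Type := Frac {
  f_pos : tm G N0;
  f_neg : tm G N0;
  f_den : tm G N0
}.

Definition frac_lift {G D} {e : Ext G D} (p : frac G) : frac D :=
  Frac ↑(f_pos p) ↑(f_neg p) ↑(f_den p).

Definition frac_zero {G} : frac G := Frac 0 0 1.

Definition frac_add {G} (p q : frac G) : frac G :=
  Frac (f_pos p * f_den q + f_pos q * f_den p)
       (f_neg p * f_den q + f_neg q * f_den p)
       (f_den p * f_den q).

Definition frac_lt {G} (p q : frac G) : fm G :=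
  f_pos p * f_den q + f_neg q * f_den p ≺ f_pos q * f_den p + f_neg p * f_den q.
Definition frac_le {G} (p q : frac G) : fm G :=
  f_pos p * f_den q + f_neg q * f_den p ≼ f_pos q * f_den p + f_neg p * f_den q.

Definition pow2 {G} (n : tm G N0) : tm G N0 :=
  cRec · (λ j : N0, λ r : N0, r + r) · 1 · n.
Definition inv_pow2 {G} (n : tm G N0) : frac G := Frac 1 0 (pow2 n).
Definition two_inv_pow2 {G} (n : tm G N0) : frac G := Frac (1 + 1) 0 (pow2 n).

Definition pair00 {G} (a b : tm G N0) : tm G N0 := (a + b) * (a + b) + a.

(** The number [((a, b), c)] codes the rational [(a - b) / (c + 1)]; integers
    are thus coded by pairs of numbers. *)
Definition rat_code {G} (a b c : tm G N0) : tm G N0 := pair00 (pair00 a b) c.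

Definition with_rats {G} (P : forall D, frac D -> frac D -> fm D)
    (k l : tm G N0) (r s : frac G) : fm G :=
  ∃ a : N0, ∃ b : N0, ∃ c : N0, ∃ a' : N0, ∃ b' : N0, ∃ c' : N0,
    ↑k ≐ rat_code ↑a ↑b ↑c ∧ ↑l ≐ rat_code ↑a' ↑b' c' ∧
    P _ (frac_add (Frac ↑a ↑b (↑c + 1)) (frac_lift r))
        (frac_add (Frac ↑a' ↑b' (c' + 1)) (frac_lift s)).

(** [k] and [l] are codes of rationals [p] and [q], and [p + r < q + s]
    (respectively [p + r <= q + s]). *)
Definition rat_lt {G} (k : tm G N0) (r : frac G) (l : tm G N0) (s : frac G)
  : fm G := with_rats (fun D => @frac_lt D) k l r s.
Definition rat_le {G} (k : tm G N0) (r : frac G) (l : tm G N0) (s : frac G)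
  : fm G := with_rats (fun D => @frac_le D) k l r s.

Definition is_real {G} (x : tm G N1) : fm G :=
  ∀ n : N0, ∀ i : N0,
    rat_lt (↑x · ↑n) frac_zero (↑x · (↑n + i)) (inv_pow2 ↑n) ∧
    rat_lt (↑x · (↑n + i)) frac_zero (↑x · ↑n) (inv_pow2 ↑n).

Definition real_le {G} (x y : tm G N1) : fm G :=
  ∀ n : N0, rat_le (↑x · n) frac_zero (↑y · n) (two_inv_pow2 n).

(** [|x - y| < 2^-k]: for some [n], [|x_n - y_n| + 2^(1-n) < 2^-k]. *)
Definition real_close {G} (x y : tm G N1) (k : tm G N0) : fm G :=
  ∃ n : N0,
    rat_lt (↑x · n) (two_inv_pow2 n) (↑y · n) (inv_pow2 ↑k) ∧
    rat_lt (↑y · n) (two_inv_pow2 n) (↑x · n) (inv_pow2 ↑k).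

Definition real_eq {G} (x y : tm G N1) : fm G := real_le x y ∧ real_le y x.

Definition real0 {G} : tm G N1 := λ n : N0, rat_code 0 0 0.
Definition real1 {G} : tm G N1 := λ n : N0, rat_code 1 0 0.

Definition in_unit_interval {G} (x : tm G N1) : fm G :=
  is_real x ∧ real_le real0 x ∧ real_le x real1.

Definition real_set {G} (U : tm G N2) : fm G :=
  char1 U ∧
  (∀ x : N1, ∀ y : N1,
     is_real ↑x ⟶ is_real y ⟶ real_eq ↑x y ⟶ ↑U · ↑x ≐ ↑U · y).

Definition nbhd {G} (U : tm G N2) (y : tm G N1) : fm G :=
  ∃ k : N0, ∀ z : N1, is_real z ⟶ real_close z ↑y ↑k ⟶ mem1 z ↑U.

Definition directed {G} (D : tm G N2) (R : tm G (N1 ⇒ N1 ⇒ N0)) : fm G :=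
  (∃ d : N1, mem1 d ↑D) ∧
  (∀ a : N1, ∀ b : N1, ∀ c : N1,
     mem1 ↑a ↑D ⟶ mem1 ↑b ↑D ⟶ mem1 c ↑D ⟶
     rel1 ↑R ↑a ↑b ⟶ rel1 ↑R ↑b c ⟶ rel1 ↑R ↑a c) ∧
  (∀ a : N1, mem1 a ↑D ⟶ rel1 ↑R a a) ∧
  (∀ a : N1, ∀ b : N1, mem1 ↑a ↑D ⟶ mem1 b ↑D ⟶
     ∃ c : N1, mem1 c ↑D ∧ rel1 ↑R ↑a c ∧ rel1 ↑R ↑b c).

Definition increasing {G} (D : tm G N2) (R : tm G (N1 ⇒ N1 ⇒ N0))
    (x : tm G (N1 ⇒ N1)) : fm G :=
  ∀ a : N1, ∀ b : N1, mem1 ↑a ↑D ⟶ mem1 b ↑D ⟶ rel1 ↑R ↑a b ⟶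
    real_le (↑x · ↑a) (↑x · b).

Definition converges_to {G} (D : tm G N2) (R : tm G (N1 ⇒ N1 ⇒ N0))
    (x : tm G (N1 ⇒ N1)) (y : tm G N1) : fm G :=
  ∀ U : N2, real_set U ⟶ nbhd U ↑y ⟶
    ∃ d : N1, mem1 d ↑D ∧
      (∀ e : N1, mem1 e ↑D ⟶ rel1 ↑R ↑d e ⟶ mem1 (↑x · e) ↑U).

Definition MCT_net : fm [] :=
  ∀ D : N2, ∀ R : (N1 ⇒ N1 ⇒ N0), ∀ x : (N1 ⇒ N1),
    char1 ↑D ⟶ directed ↑D ↑R ⟶
    (∀ d : N1, mem1 d ↑D ⟶ in_unit_interval (↑x · d)) ⟶
    increasing ↑D ↑R x ⟶
    ∃ y : N1, is_real y ∧ converges_to ↑D ↑R ↑x y.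

(* Main.v *)
(** By a Henkin construction, [prv] is complete with respect to extensional
    many-sorted structures in which [≐] is interpreted by identity. Hence it
    suffices to argue in an arbitrary such model of the theory.

    There, let a sequence [f] code the set [S_f] of all [n] such that
    [Y(f_i, n) = 0] for some row [f_i] of [f]. Ordered by inclusion of these
    sets, the sequences form a directed set, and [x_f], the sum of [2^-(n+1)]
    over [n] in [S_f], is an increasing net in the unit interval. Let [y] be its
    limit. If [x_g] is within [2^-(n+2)] of [y], then [n] belongs to [S_g] as
    soon as it belongs to any [S_f]: otherwise some [h] beyond both [f] and [g]
    has [x_h] within [2^-(n+2)] of [y] as well, although
    [x_h >= x_g + 2^-(n+1)]. Hence [exists f, Y(f, n) = 0] is equivalent to
    [n] being in [S_g] for all [g] with [|x_g - y| < 2^-(n+2)], and Δ-CA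
    applies. *)
From Stdlib Require Import List Arith Lia Cantor Ring Setoid Morphisms.
From Stdlib Require Import Eqdep Classical ClassicalEpsilon ProofIrrelevance.
From Stdlib Require Import FunctionalExtensionality PropExtensionality.
Require Import Defs.
Import ListNotations.

Set Implicit Arguments.
Unset Strict Implicit.
Unset Printing Implicit Defensive.

Open Scope ty_scope.
Open Scope tm_scope.
Open Scope fm_scope.

(** * Substitution *)

(** The model may be nonstandard, so numbers, rationals, powers of two and partial sums are all
    objects of the model, and induction is available only for quantifier-free formulas of the
    language. Each inductive statement is therefore written as such a formula, and where an
    existential quantifier would be natural a functional built from the recursor supplies the
    witness. Comprehension has two sources: quantifier-free choice yields characteristic functionals
    of quantifier-free formulas, and μ absorbs number quantifiers. Membership in one [S_f],
    inclusion of such sets and closeness to [y] are thus decided by functionals, whereas membership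
    in some [S_f] quantifies over sequences and is out of reach. The limit of the net is what turns
    this existential quantifier over sequences into a universal one, the form that Δ-CA asks for. A
    sequence codes a whole family of arguments of [Y], not a single one, because the sets attached
    to single arguments need not be closed under union, and the order could fail to be directed. *)

Definition var_case {G s} (P : forall t, var (s :: G) t -> Type)
    (p0 : P s V0) (pS : forall t (v : var G t), P t (VS v)) t
    (v : var (s :: G) t) : P t v :=
  match v in var L t
    return match L return var L t -> Type with
           | [] => fun _ => unit
           | s :: G => fun v => forall P : (forall t, var (s :: G) t -> Type),
               P s V0 -> (forall t (v : var G t), P t (VS v)) -> P t v
           end v
  with
  | V0 => fun P p0 _ => p0
  | VS w => fun P _ pS => pS _ w
  end P p0 pS.

Lemma var_nil t (v : var [] t) : False.
Proof. inversion v. Qed.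

Lemma sub_ext G D (f g : sub G D) : (forall t v, f t v = g t v) -> f = g.
Proof.
  intros H; apply functional_extensionality_dep; intros t.
  apply functional_extensionality; apply H.
Qed.

Lemma sub_ext_cons G D s (f g : sub (s :: G) D) :
  f s V0 = g s V0 -> (forall t v, f t (VS v) = g t (VS v)) -> f = g.
Proof.
  intros H0 HS; apply sub_ext; intros t v.
  revert t v; apply var_case; auto.
Qed.

Definition sub_ren {G D} (r : ren G D) : sub G D := fun t v => tVar (r t v).
Definition sub_comp {G D E} (f : sub G D) (g : sub D E) : sub G E :=
  fun t v => tsub g (f t v).

Lemma tren_tsub G D (r : ren G D) t (u : tm G t) : tren r u = tsub (sub_ren r) u.
Proof. induction u; cbn; try reflexivity; congruence. Qed.

Lemma tsub_comp G D E (f : sub G D) (g : sub D E) t (u : tm G t) :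
  tsub g (tsub f u) = tsub (sub_comp f g) u.
Proof. induction u; cbn; try reflexivity; congruence. Qed.

Lemma tsub_id G t (u : tm G t) : tsub sub_id u = u.
Proof. induction u; cbn; try reflexivity; congruence. Qed.

Lemma sub_up_ren G D s (r : ren G D) :
  sub_ren (ren_up (s := s) r) = sub_up (sub_ren r).
Proof. apply sub_ext_cons; reflexivity. Qed.

Lemma sub_up_id G s : sub_up (s := s) (@sub_id G) = sub_id.
Proof. apply sub_ext_cons; reflexivity. Qed.

Lemma sub_up_comp G D E s (f : sub G D) (g : sub D E) :
  sub_comp (sub_up (s := s) f) (sub_up g) = sub_up (sub_comp f g).
Proof.
  apply sub_ext_cons; [reflexivity|]; intros t v; unfold sub_comp, sub_up; cbn.
  rewrite !tren_tsub, !tsub_comp; f_equal.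
  apply sub_ext; intros; unfold sub_comp; cbn; now rewrite tren_tsub.
Qed.

Lemma fren_fsub G (A : fm G) : forall D (r : ren G D), fren A r = fsub A (sub_ren r).
Proof.
  induction A; intros D r; cbn; rewrite ?tren_tsub; try congruence;
    now rewrite IHA, sub_up_ren.
Qed.

Lemma fsub_comp G (A : fm G) : forall D E (f : sub G D) (g : sub D E),
  fsub (fsub A f) g = fsub A (sub_comp f g).
Proof.
  induction A; intros D E f g; cbn; rewrite ?tsub_comp; try congruence;
    now rewrite IHA, sub_up_comp.
Qed.

Lemma fsub_id G (A : fm G) : fsub A sub_id = A.
Proof.
  induction A; cbn; rewrite ?tsub_id; try congruence;
    now rewrite sub_up_id, IHA.
Qed.

Lemma sub_comp_ren G D E (f : sub G D) (r : ren D E) :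
  sub_comp f (sub_ren r) = fun t v => tren r (f t v).
Proof.
  apply sub_ext; intros; unfold sub_comp; now rewrite tren_tsub.
Qed.

Lemma sub_up_cons G D s (f : sub G D) (u : tm D s) :
  sub_comp (sub_up f) (sub_cons u sub_id) = sub_cons u f.
Proof.
  apply sub_ext_cons; [reflexivity|]; intros t v; unfold sub_comp, sub_up; cbn.
  rewrite tren_tsub, tsub_comp; rewrite <- (tsub_id (f t v)) at 2; f_equal.
Qed.

Lemma inst_sub_up G D s (A : fm (s :: G)) (f : sub G D) (u : tm D s) :
  inst (fsub A (sub_up f)) u = fsub A (sub_cons u f).
Proof. unfold inst; now rewrite fsub_comp, sub_up_cons. Qed.

Lemma inst_shift_V0 G s (A : fm (s :: G)) :
  inst (fren A (ren_up shift)) (tVar V0) = A.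
Proof.
  unfold inst; rewrite fren_fsub, fsub_comp; rewrite <- (fsub_id A) at 2.
  f_equal; apply sub_ext_cons; reflexivity.
Qed.

Lemma fsub_inst G D s (A : fm (s :: G)) (u : tm G s) (f : sub G D) :
  fsub (inst A u) f = inst (fsub A (sub_up f)) (tsub f u).
Proof.
  rewrite inst_sub_up; unfold inst; rewrite fsub_comp; f_equal.
  apply sub_ext_cons; reflexivity.
Qed.

Lemma tsub_shift G D s (f : sub G D) t (u : tm G t) :
  tsub (sub_up (s := s) f) (tren shift u) = tren shift (tsub f u).
Proof.
  rewrite !tren_tsub, !tsub_comp; f_equal; rewrite sub_comp_ren; reflexivity.
Qed.

Lemma fsub_eqt G t : forall (a b : tm G t) D (f : sub G D),
  fsub (eqt a b) f = eqt (tsub f a) (tsub f b).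
Proof.
  revert G; induction t as [|s _ t IH]; intros G a b D f; [reflexivity|].
  cbn; unfold all; cbn; f_equal; rewrite IH; cbn.
  unfold lift; fold (@shift G s); fold (@shift D s).
  change (ext : ren G (s :: G)) with (@shift G s).
  change (ext : ren D (s :: D)) with (@shift D s).
  now rewrite !(@tsub_shift G D s f).
Qed.

Lemma qf_fsub G (A : fm G) : forall D (f : sub G D), qf A -> qf (fsub A f).
Proof. induction A; cbn; firstorder. Qed.

(** Lets an axiom be read at arbitrary elements of the term model, whose terms live in the contexts
    of the stages. *)
Definition sub_closed (T : theory) : Prop :=
  forall G (A : fm G) D (f : sub G D), T G A -> T D (fsub A f).

Lemma add_axiom_sub_closed T A : sub_closed T -> sub_closed (add_axiom T A).
Proof.
  intros HT G B D f [H| ->]; [left; auto|right].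
  rewrite !fren_fsub, fsub_comp; f_equal; apply sub_ext; intros t v.
  destruct (var_nil v).
Qed.

(** The axioms are schemata over all contexts, so a substituted instance is mostly an instance again
    at once. Induction and choice need an argument, because their own substitutions have to be moved
    past the given one. *)
Lemma RCA0w_sub_closed : sub_closed RCA0w.
Proof.
  intros G A D f H; destruct H;
    try (cbn; rewrite ?fsub_eqt; constructor; fail).
  - cbn. unfold inst_zero; rewrite fsub_inst.
    replace (fsub (inst_succ A) (sub_up f)) with (inst_succ (fsub A (sub_up f))).
    { apply (@ax_ind D (fsub A (sub_up f))); now apply qf_fsub. }
    unfold inst_succ; rewrite !fsub_comp; f_equal.
    apply sub_ext_cons; [reflexivity|]; intros; unfold sub_comp, sub_up; cbn.
    rewrite tren_tsub, tsub_comp; reflexivity.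
  - unfold QF_AC; cbn.
    match goal with |- RCA0w (fImp (fAll (fEx ?B)) (fEx (fAll ?C))) =>
      replace C with (fsub B
    (sub_cons (D := N1 :: (N1 ⇒ N0) :: D) (tVar (VS V0) · tVar V0)
      (sub_cons (tVar V0) (fun r v => tVar (VS (VS v)))))) end.
    { apply (@ax_choice D); now apply qf_fsub. }
    rewrite !fsub_comp; f_equal.
    apply sub_ext_cons; [reflexivity|]; intros t v; pattern t, v.
    apply var_case; [reflexivity|clear]; intros t v; unfold sub_comp, sub_up; cbn.
    rewrite !tren_tsub, !tsub_comp; reflexivity.
Qed.

(** * Enumeration of formulas *)

Definition npair (a b : nat) : nat := Cantor.to_nat (a, b).

Lemma npair_inj a b c d : npair a b = npair c d -> a = c /\ b = d.
Proof.
  intros H; apply (f_equal Cantor.of_nat) in H; unfold npair in H.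
  rewrite !Cantor.cancel_of_to in H; now inversion H.
Qed.

Global Opaque npair.

Fixpoint ty_code (t : ty) : nat :=
  match t with
  | N0 => 0
  | Arr s t => S (npair (ty_code s) (ty_code t))
  end.

Fixpoint var_code {G t} (v : var G t) : nat :=
  match v with V0 => 0 | VS w => S (var_code w) end.

Fixpoint tm_code {G t} (u : tm G t) : nat :=
  match u with
  | tVar v => npair 0 (var_code v)
  | tApp a b => npair 1 (npair (tm_code a) (tm_code b))
  | cZero => npair 2 0
  | cOne => npair 3 0
  | cAdd => npair 4 0
  | cMul => npair 5 0
  | cPi s t => npair 6 (npair (ty_code s) (ty_code t))
  | cSigma r s t => npair 7 (npair (ty_code r) (npair (ty_code s) (ty_code t)))
  | cRec => npair 8 0
  end.

Fixpoint fm_code {G} (A : fm G) : nat :=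
  match A with
  | fBot => npair 0 0
  | fEq a b => npair 1 (npair (tm_code a) (tm_code b))
  | fLt a b => npair 2 (npair (tm_code a) (tm_code b))
  | fImp A B => npair 3 (npair (fm_code A) (fm_code B))
  | fAnd A B => npair 4 (npair (fm_code A) (fm_code B))
  | fOr A B => npair 5 (npair (fm_code A) (fm_code B))
  | @fAll _ s A => npair 6 (npair (ty_code s) (fm_code A))
  | @fEx _ s A => npair 7 (npair (ty_code s) (fm_code A))
  end.

Lemma ty_code_inj s : forall t, ty_code s = ty_code t -> s = t.
Proof.
  induction s as [|s1 IH1 s2 IH2]; intros [|t1 t2]; cbn; intros H;
    try discriminate; auto.
  injection H as H; apply npair_inj in H as [H1 H2]; f_equal; auto.
Qed.

Ltac split_code :=
  repeat match goal with
  | H : npair _ _ = npair _ _ |- _ => apply npair_inj in H as [? ?]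
  | H : ty_code _ = ty_code _ |- _ => apply ty_code_inj in H; subst
  end.

Lemma var_code_inj G s (v : var G s) : forall t (w : var G t),
  var_code v = var_code w -> existT (var G) s v = existT (var G) t w.
Proof.
  induction v as [G s|G s r v IH]; intros t w; revert t w;
    refine (var_case (P := fun t w => _ = var_code w -> _ = existT (var (s :: G)) t w) _ _);
    cbn; intros; try discriminate; auto.
  injection H as H; apply IH in H; now inversion_sigma H; subst.
Qed.

(** The code of an application omits the type of the argument, so injectivity is proved across
    types: the code of the function part determines its type, and with it the type of the
    argument. *)
Lemma tm_code_inj G s (u : tm G s) : forall t (w : tm G t),
  tm_code u = tm_code w -> existT (tm G) s u = existT (tm G) t w.
Proof.
  induction u; intros t' w; destruct w; cbn; intros H; split_code;
    try discriminate; auto.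
  - match goal with E : var_code _ = var_code _ |- _ =>
      apply var_code_inj in E; now inversion_sigma E; subst end.
  - match goal with E1 : tm_code u1 = _, E2 : tm_code u2 = _ |- _ =>
      apply IHu1 in E1; apply IHu2 in E2;
      pose proof (projT1_eq E1) as E; cbn in E; injection E; intros; subst;
      apply inj_pair2 in E1; apply inj_pair2 in E2; now subst end.
Qed.

Lemma tm_code_inj0 G s (u w : tm G s) : tm_code u = tm_code w -> u = w.
Proof. intros H; apply tm_code_inj in H; now apply inj_pair2 in H. Qed.

Lemma fm_code_inj G (A : fm G) : forall B : fm G, fm_code A = fm_code B -> A = B.
Proof.
  induction A as [G|G a b|G a b|G A IHA B IHB|G A IHA B IHB|G A IHA B IHB
                 |G s A IHA|G s A IHA]; intros C; destruct C; cbn; intros H;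
    split_code; try discriminate; f_equal; auto using tm_code_inj0.
Qed.

Definition fm_enum {G} (n : nat) : fm G :=
  match excluded_middle_informative (exists A : fm G, fm_code A = n) with
  | left H => proj1_sig (constructive_indefinite_description _ H)
  | right _ => fBot
  end.

Lemma fm_enum_code G (A : fm G) : fm_enum (fm_code A) = A.
Proof.
  unfold fm_enum; destruct excluded_middle_informative as [H|H].
  - apply fm_code_inj; now destruct constructive_indefinite_description.
  - destruct H; eauto.
Qed.

(** * Models *)

Record model : Type := Model {
  dom : ty -> Type;
  app : forall s t, dom (s ⇒ t) -> dom s -> dom t;
  mzero : dom N0;
  mone : dom N0;
  madd : dom (N0 ⇒ N0 ⇒ N0);
  mmul : dom (N0 ⇒ N0 ⇒ N0);
  mpi : forall s t, dom (s ⇒ t ⇒ s);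
  msigma : forall r s t, dom ((r ⇒ s ⇒ t) ⇒ (r ⇒ s) ⇒ (r ⇒ t));
  mrec : dom ((N0 ⇒ N0 ⇒ N0) ⇒ N0 ⇒ N0 ⇒ N0);
  mlt : dom N0 -> dom N0 -> Prop
}.

Definition env (M : model) (G : ctx) : Type := forall t, var G t -> dom M t.

Definition env_nil {M} : env M [] := fun t v => match var_nil v with end.

Definition env_cons {M G s} (x : dom M s) (e : env M G) : env M (s :: G) :=
  fun t v =>
    match v in var L t
      return match L with
             | [] => unit
             | s :: G => dom M s -> env M G -> dom M t
             end
    with
    | V0 => fun x _ => x
    | VS w => fun _ e => e _ w
    end x e.

Fixpoint ev (M : model) {G t} (e : env M G) (u : tm G t) : dom M t :=
  match u with
  | tVar v => e _ v
  | tApp a b => app (ev e a) (ev e b)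
  | cZero => mzero M
  | cOne => mone M
  | cAdd => madd M
  | cMul => mmul M
  | cPi s t => mpi M s t
  | cSigma r s t => msigma M r s t
  | cRec => mrec M
  end.

Fixpoint sat (M : model) {G} (A : fm G) : env M G -> Prop :=
  match A with
  | fBot => fun _ => False
  | fEq a b => fun e => ev e a = ev e b
  | fLt a b => fun e => mlt (ev e a) (ev e b)
  | fImp A B => fun e => sat A e -> sat B e
  | fAnd A B => fun e => sat A e /\ sat B e
  | fOr A B => fun e => sat A e \/ sat B e
  | fAll A => fun e => forall x, sat A (env_cons x e)
  | fEx A => fun e => exists x, sat A (env_cons x e)
  end.

Definition extensional (M : model) : Prop :=
  forall s t (f g : dom M (s ⇒ t)), (forall x, app f x = app g x) -> f = g.

Definition models (M : model) (T : theory) : Prop :=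
  forall G (A : fm G), T G A -> forall e : env M G, sat A e.

(** * Completeness *)

Definition eventually (P : nat -> Prop) : Prop :=
  exists n0, forall n, n0 <= n -> P n.

Lemma eventually_all (P : nat -> Prop) : (forall n, P n) -> eventually P.
Proof. exists O; auto. Qed.

Lemma eventually_mp (P Q : nat -> Prop) :
  eventually (fun n => P n -> Q n) -> eventually P -> eventually Q.
Proof.
  intros [n1 H1] [n2 H2]; exists (n1 + n2)%nat; intros n Hn.
  apply H1; [lia|apply H2; lia].
Qed.

Lemma eventually_impl (P Q : nat -> Prop) :
  (forall n, P n -> Q n) -> eventually P -> eventually Q.
Proof. intros H; apply eventually_mp, eventually_all, H. Qed.

Lemma eventually_and (P Q : nat -> Prop) :
  eventually P -> eventually Q -> eventually (fun n => P n /\ Q n).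
Proof.
  intros [n1 H1] [n2 H2]; exists (n1 + n2)%nat; intros n Hn.
  split; [apply H1|apply H2]; lia.
Qed.

Lemma eventually_ex (P : nat -> Prop) : eventually P -> exists n, P n.
Proof. intros [n H]; eauto. Qed.

(** Inhabits the stages before the one at which a given term makes sense; see [tcompat_from]. *)
Fixpoint default {G} t : tm G t :=
  match t with
  | N0 => cZero
  | Arr s t => tApp (cPi t s) (default t)
  end.

(** A formula that is not existential receives a trivial witness formula in a fresh number variable,
    so that every stage extends the context by exactly one variable. *)
Definition witness {G} (A : fm G) : {s & fm (s :: G)} :=
  match A in fm G return {s & fm (s :: G)} with
  | @fEx G s A => existT _ s A
  | _ => existT _ N0 (fImp fBot fBot)
  end.

Lemma lift_shift G s t (u : tm G t) : lift (D := s :: G) u = tren shift u.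
Proof. reflexivity. Qed.

Lemma fren_eqt_app D s r t (f g : tm D (s ⇒ t)) :
  fren (eqt (tApp (lift f) (tVar (V0 (s := s)))) (tApp (lift g) (tVar V0)))
    (ren_up (shift (s := r))) =
  eqt (tApp (lift (tren shift f)) (tVar V0)) (tApp (lift (tren shift g)) (tVar V0)).
Proof.
  rewrite !lift_shift, fren_fsub, fsub_eqt, sub_up_ren; cbn [tsub].
  now rewrite !tsub_shift, <- !tren_tsub.
Qed.

(** * A complete theory with witnesses, built in stages *)

Section Henkin.

Variable T : theory.
Hypothesis T_sub : sub_closed T.
Hypothesis T_RCA : forall G (A : fm G), RCA0w A -> T A.
Variable H0 : list (fm []).
Hypothesis H0_con : ~ prv T H0 fBot.

Notation con H := (~ prv T H fBot).

Lemma prv_witness G (H : list (fm G)) A :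
  prv T (A :: H) (fEx (projT2 (witness A))).
Proof.
  destruct A; cbn; try (apply p_ex_i with (u := cZero); cbn; apply p_imp_i;
    apply p_hyp; left; reflexivity).
  apply p_hyp; now left.
Qed.

Definition choose {G} (H : list (fm G)) (A : fm G) : fm G :=
  if excluded_middle_informative (con (A :: H)) then A else ¬ A.

Lemma choose_con G (H : list (fm G)) A : con H -> con (choose H A :: H).
Proof.
  intros HH; unfold choose; destruct excluded_middle_informative as [C|C]; auto.
  apply NNPP in C; intros D; apply HH.
  apply p_imp_e with A; [now apply p_imp_i|now apply p_dne].
Qed.

Lemma choose_in G (H : list (fm G)) A : con H -> In A H -> choose H A = A.
Proof.
  intros HH HA; unfold choose; destruct excluded_middle_informative as [C|C]; auto.
  apply NNPP in C; exfalso; apply HH.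
  apply p_imp_e with A; [now apply p_imp_i|now apply p_hyp].
Qed.

Record stage : Type := Stage {
  sctx : ctx;
  shyp : list (fm sctx);
  squeue : nat -> nat -> fm sctx
}.

Definition next_hyp {G} (H : list (fm G)) (A : fm G)
    : list (fm (projT1 (witness A) :: G)) :=
  projT2 (witness A) :: map (fun B => fren B shift) (A :: H).

(** The stage number is read as a pair (i, j) and schedules the j-th formula of stage i. Cantor
    pairing gives i ≤ n, so that stage has already been reached. *)
Definition chosen n (x : stage) : fm (sctx x) :=
  choose (shyp x) (let (i, j) := Cantor.of_nat n in squeue x i j).

(** Every stage adds a variable, so that passing to the next context is always
    [shift]; the queue holds at [i] an enumeration of the formulas of stage
    [i], transported to the current context. *)
Definition next n (x : stage) : stage :=
  Stage (next_hyp (shyp x) (chosen n x))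
    (fun i j => if Nat.eqb i (S n) then fm_enum j
                else fren (squeue x i j) shift).

Fixpoint stages n : stage :=
  match n with
  | O => Stage H0 (fun _ j => fm_enum j)
  | S n => next n (stages n)
  end.

Notation G n := (sctx (stages n)).
Notation H n := (shyp (stages n)).

(** The new variable does not occur in the shifted formulas, so existential elimination discharges
    the witness formula. *)
Lemma next_hyp_con G (H : list (fm G)) A : con (A :: H) -> con (next_hyp H A).
Proof.
  intros HH D; apply HH.
  apply (p_ex_e (A := projT2 (witness A)) (C := fBot)); [apply prv_witness|exact D].
Qed.

Lemma stages_con n : con (H n).
Proof.
  induction n as [|n IH]; [exact H0_con|cbn].
  apply next_hyp_con; unfold chosen; now apply choose_con.
Qed.

Lemma shyp_shift n A : In A (H n) -> In (fren A shift) (H (S n)).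
Proof.
  intros HA; cbn; right; right.
  now apply (in_map (fun B => fren B shift)).
Qed.

Lemma squeue_diag n j : squeue (stages n) n j = fm_enum j.
Proof. destruct n; cbn -[Nat.eqb]; now rewrite ?Nat.eqb_refl. Qed.

(** A formula of the limit language is represented by a family over all stages that is eventually
    carried along by [shift]; finitely many initial members may be arbitrary. No direct limit of the
    contexts has to be formed. *)
Definition fcompat (A : forall n, fm (G n)) : Prop :=
  eventually (fun n => A (S n) = fren (A n) shift).

(** Take a stage m beyond both [n0] and the point where the family becomes compatible, and let j be
    the code of its member there. The queue carries this formula along, and the stage whose number
    codes (m, j) treats it; that number is at least m. *)
Lemma chosen_queue (A : forall n, fm (G n)) n0 :
  fcompat A -> exists n, n0 <= n /\ chosen n (stages n) = choose (H n) (A n).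
Proof.
  intros [n1 HA].
  set (m := (n0 + n1)%nat); set (j := fm_code (A m)).
  assert (Q : forall k, squeue (stages (k + m)) m j = A (k + m)%nat).
  { induction k as [|k IH].
    - cbn; rewrite squeue_diag; apply fm_enum_code.
    - cbn [Nat.add stages next squeue].
      destruct (Nat.eqb_spec m (S (k + m))) as [E|_]; [lia|].
      rewrite IH, HA by lia; reflexivity. }
  pose proof (Cantor.to_nat_non_decreasing m j) as L.
  set (n := Cantor.to_nat (m, j)) in *.
  exists n; split; [lia|]; unfold chosen, n; rewrite Cantor.cancel_of_to; fold n.
  f_equal; specialize (Q (n - m)%nat).
  now replace (n - m + m)%nat with n in Q by lia.
Qed.

(** * Truth in the limit theory *)

Definition Tr (A : forall n, fm (G n)) : Prop := eventually (fun n => In (A n) (H n)).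

Lemma Tr_from (A : forall n, fm (G n)) n0 :
  (forall n, n0 <= n -> A (S n) = fren (A n) shift) ->
  In (A n0) (H n0) -> Tr A.
Proof.
  intros HA HI; exists n0; intros n Hn.
  induction Hn as [|n Hn IH]; [exact HI|].
  rewrite HA by exact Hn; now apply shyp_shift.
Qed.

Lemma fcompat_imp A B : fcompat A -> fcompat B -> fcompat (fun n => A n ⟶ B n).
Proof.
  intros HA HB; generalize (eventually_and HA HB); apply eventually_impl.
  intros n [-> ->]; reflexivity.
Qed.

Lemma next_hyp_in D (L : list (fm D)) A B :
  A = B -> In (fren B shift) (next_hyp L A).
Proof. intros ->; right; now left. Qed.

Lemma Tr_decide A : fcompat A -> Tr A \/ Tr (fun n => ¬ A n).
Proof.
  intros HA; pose proof HA as [n0 HA0].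
  destruct (chosen_queue n0 HA) as [n [Hn E]].
  assert (I : In (fren (choose (H n) (A n)) shift) (H (S n))).
  { exact (next_hyp_in (H n) E). }
  unfold choose in I at 1; destruct excluded_middle_informative.
  - left; apply (@Tr_from A (S n)); [intros; apply HA0; lia|].
    now rewrite HA0.
  - right; apply (@Tr_from (fun n => ¬ A n) (S n)); cbn beta.
    + intros; cbn [fren]; rewrite HA0 by lia; reflexivity.
    + now rewrite HA0.
Qed.

Lemma Tr_not_both A : Tr A -> Tr (fun n => ¬ A n) -> False.
Proof.
  intros H1 H2; destruct (eventually_ex (eventually_and H1 H2)) as [n [I1 I2]].
  apply (@stages_con n); apply p_imp_e with (A n); now apply p_hyp.
Qed.

(** Deductive closure follows from completeness: if the negation were true instead, some stage would
    contain it and also prove the formula, against consistency. *)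
Lemma Tr_ded A : fcompat A -> eventually (fun n => prv T (H n) (A n)) -> Tr A.
Proof.
  intros HA HP; destruct (Tr_decide HA) as [|HN]; auto.
  exfalso; destruct (eventually_ex (eventually_and HP HN)) as [n [I1 I2]].
  apply (@stages_con n); apply p_imp_e with (A n); auto; now apply p_hyp.
Qed.

Lemma Tr_prv A : Tr A -> eventually (fun n => prv T (H n) (A n)).
Proof. apply eventually_impl; intros; now apply p_hyp. Qed.

Lemma Tr_bot : ~ Tr (fun n => fBot).
Proof.
  intros HT; destruct (eventually_ex (Tr_prv HT)) as [n Hn].
  exact (stages_con Hn).
Qed.

Lemma Tr_mp A B : fcompat B -> Tr (fun n => A n ⟶ B n) -> Tr A -> Tr B.
Proof.
  intros HB H1 H2; apply Tr_ded; auto.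
  generalize (eventually_and (Tr_prv H1) (Tr_prv H2)); apply eventually_impl.
  intros n [P1 P2]; now apply p_imp_e with (A n).
Qed.

Lemma Tr_imp A B : fcompat A -> fcompat B ->
  (Tr (fun n => A n ⟶ B n) <-> (Tr A -> Tr B)).
Proof.
  intros HA HB; split; [intros H1 H2; now apply (Tr_mp HB H1)|].
  intros HI; apply Tr_ded; [now apply fcompat_imp|].
  destruct (Tr_decide HA) as [H1|H1].
  - generalize (HI H1); apply eventually_impl; intros n I.
    apply p_imp_i, p_hyp; now right.
  - generalize H1; apply eventually_impl; intros n I.
    apply p_imp_i, p_dne, p_imp_e with (A n); apply p_hyp; cbn; auto.
Qed.

Lemma Tr_and A B : fcompat A -> fcompat B ->
  (Tr (fun n => A n ∧ B n) <-> (Tr A /\ Tr B)).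
Proof.
  intros HA HB; split.
  - intros HI; split; (apply Tr_ded; [assumption|]);
      generalize (Tr_prv HI); apply eventually_impl; intros n I;
      [now apply p_and_e1 with (B n)|now apply p_and_e2 with (A n)].
  - intros [H1 H2]; apply Tr_ded.
    + generalize (eventually_and HA HB); apply eventually_impl.
      intros n [-> ->]; reflexivity.
    + generalize (eventually_and (Tr_prv H1) (Tr_prv H2)); apply eventually_impl.
      intros n [I1 I2]; now apply p_and_i.
Qed.

Lemma Tr_or A B : fcompat A -> fcompat B ->
  (Tr (fun n => A n ∨ B n) <-> (Tr A \/ Tr B)).
Proof.
  intros HA HB; split.
  - intros HI; destruct (Tr_decide HA) as [H1|H1]; [now left|right].
    apply Tr_ded; [assumption|].
    generalize (eventually_and HI H1); apply eventually_impl; intros n [I1 I2].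
    apply p_or_e with (A n) (B n); [now apply p_hyp| |apply p_hyp; now left].
    apply p_dne, p_imp_e with (A n); apply p_hyp; cbn; auto.
  - intros HI; apply Tr_ded.
    + generalize (eventually_and HA HB); apply eventually_impl.
      intros n [-> ->]; reflexivity.
    + destruct HI as [HI|HI]; generalize (Tr_prv HI); apply eventually_impl;
        intros n I; [now apply p_or_i1|now apply p_or_i2].
Qed.

Definition tcompat t (a : forall n, tm (G n) t) : Prop :=
  eventually (fun n => a (S n) = tren shift (a n)).

Definition bcompat s (B : forall n, fm (s :: G n)) : Prop :=
  eventually (fun n => B (S n) = fren (B n) (ren_up shift)).

(** Before stage m the family consists of shifted default terms, at m it is [u], and afterwards [u]
    is shifted onwards. *)
Lemma tcompat_from m t (u : tm (G m) t) :
  exists a : forall n, tm (G n) t, a m = u /\ forall n, m <= n -> a (S n) = tren shift (a n).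
Proof.
  set (a := fix a n : tm (G n) t :=
    match Nat.eq_dec m n with
    | left e => eq_rect m (fun k => tm (G k) t) u n e
    | right _ =>
        match n with O => default t | S n => tren shift (a n) end
    end).
  exists a; split.
  - destruct m; cbn -[Nat.eq_dec]; destruct Nat.eq_dec as [e|e]; try congruence;
      now rewrite (Peano_dec.UIP_nat _ _ e eq_refl).
  - intros n Hn; cbn -[Nat.eq_dec]; destruct Nat.eq_dec as [e|e]; [lia|reflexivity].
Qed.

Lemma inst_shift D s r (A : fm (s :: D)) (u : tm D s) :
  inst (fren A (ren_up (shift (s := r)))) (tren shift u) = fren (inst A u) shift.
Proof.
  unfold inst; rewrite !fren_fsub, !fsub_comp; f_equal.
  apply sub_ext_cons; [unfold sub_comp; cbn; apply tren_tsub|reflexivity].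
Qed.

Lemma fcompat_inst s (B : forall n, fm (s :: G n)) (w : forall n, tm (G n) s) :
  bcompat B -> tcompat w -> fcompat (fun n => inst (B n) (w n)).
Proof.
  intros HB Hw; generalize (eventually_and HB Hw); apply eventually_impl.
  intros n [-> ->]; apply inst_shift.
Qed.

Lemma fcompat_ex s (B : forall n, fm (s :: G n)) :
  bcompat B -> fcompat (fun n => fEx (B n)).
Proof. apply eventually_impl; intros n ->; reflexivity. Qed.

Lemma fcompat_all s (B : forall n, fm (s :: G n)) :
  bcompat B -> fcompat (fun n => fAll (B n)).
Proof. apply eventually_impl; intros n ->; reflexivity. Qed.

Lemma next_hyp_witness D (L : list (fm D)) s (A : fm (s :: D)) C :
  C = fEx A ->
  exists u, In (inst (fren A (ren_up shift)) u) (next_hyp L C).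
Proof.
  intros ->; exists (tVar V0); left; cbn; symmetry; apply inst_shift_V0.
Qed.

(** A true existential formula is treated at a stage where it is already a hypothesis, hence it is
    chosen as it stands. The variable added by that stage, shifted onwards, is the witness. *)
Lemma Tr_ex s (B : forall n, fm (s :: G n)) : bcompat B ->
  (Tr (fun n => fEx (B n)) <->
   exists w : forall n, tm (G n) s, tcompat w /\ Tr (fun n => inst (B n) (w n))).
Proof.
  intros HB; split.
  - intros [n0 HI]; pose proof HB as [n1 HB1].
    destruct (chosen_queue (n0 + n1) (fcompat_ex HB)) as [n [Hn E]].
    rewrite choose_in in E; [|apply stages_con|apply HI; lia].
    destruct (next_hyp_witness (H n) E) as [u Hu].
    destruct (tcompat_from (m := S n) u) as [w [Ew Hw]].
    exists w; split; [exists (S n); exact Hw|].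
    apply (@Tr_from (fun n => inst (B n) (w n)) (S n)).
    + intros k Hk; cbn beta; rewrite HB1, Hw by lia; apply inst_shift.
    + rewrite Ew, HB1 by lia; exact Hu.
  - intros [w [Hw HT]]; apply Tr_ded; [now apply fcompat_ex|].
    generalize (Tr_prv HT); apply eventually_impl; intros n I.
    now apply p_ex_i with (w n).
Qed.

Lemma prv_not_all D (L : list (fm D)) s (A : fm (s :: D)) :
  In (¬ fAll A) L -> prv T L (fEx (¬ A)).
Proof.
  intros I; apply p_dne; apply p_imp_e with (fAll A); [apply p_hyp; now right|].
  apply p_all_i, p_dne.
  apply p_imp_e with (fEx (fren (¬ A) (ren_up shift))).
  - apply p_hyp; right; now left.
  - apply p_ex_i with (tVar V0); rewrite inst_shift_V0; apply p_hyp; now left.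
Qed.

(** If the universal formula were not true, completeness and classical logic would make the
    existential formula with negated matrix true, and its witness would contradict the
    assumption. *)
Lemma Tr_all s (B : forall n, fm (s :: G n)) : bcompat B ->
  (Tr (fun n => fAll (B n)) <->
   forall w : forall n, tm (G n) s, tcompat w -> Tr (fun n => inst (B n) (w n))).
Proof.
  intros HB; split.
  - intros HT w Hw; apply Tr_ded; [now apply fcompat_inst|].
    generalize (Tr_prv HT); apply eventually_impl; intros n I.
    now apply p_all_e.
  - intros HI; destruct (Tr_decide (fcompat_all HB)) as [|HN]; [assumption|].
    exfalso.
    assert (HB' : bcompat (fun n => ¬ B n)).
    { generalize HB; apply eventually_impl; intros n ->; reflexivity. }
    assert (HE : Tr (fun n => fEx (¬ B n))).
    { apply Tr_ded; [now apply fcompat_ex|].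
      generalize HN; apply eventually_impl; intros n; apply prv_not_all. }
    rewrite (Tr_ex HB') in HE; destruct HE as [w [Hw HE]].
    exact (Tr_not_both (HI w Hw) HE).
Qed.

(** * Elements of the term model *)

Record elem t : Type := Elem {
  at_ :> forall n, tm (G n) t;
  elem_compat : tcompat at_
}.

Definition esub {D} (r : forall t, var D t -> elem t) n : sub D (G n) :=
  fun t v => r t v n.

(** A context is finite, so the stages from which its variables are compatible have a common bound;
    hence the induction on [D]. *)
Lemma esub_shift D (r : forall t, var D t -> elem t) :
  eventually (fun n => esub r (S n) = fun t v => tren shift (esub r n v)).
Proof.
  induction D as [|s D IH].
  - apply eventually_all; intros n; apply sub_ext; intros t v; destruct (var_nil v).
  - generalize (eventually_and (IH (fun t v => r t (VS v))) (elem_compat (r s V0))).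
    apply eventually_impl; intros n [E1 E2]; apply sub_ext_cons; [exact E2|].
    intros t v; exact (f_equal (fun f : sub D (G (S n)) => f t v) E1).
Qed.

Lemma tcompat_sub D (r : forall t, var D t -> elem t) t (u : tm D t) :
  tcompat (fun n => tsub (esub r n) u).
Proof.
  generalize (esub_shift r); apply eventually_impl; intros n ->.
  rewrite tren_tsub, tsub_comp, sub_comp_ren; reflexivity.
Qed.

Lemma fcompat_sub D (r : forall t, var D t -> elem t) (A : fm D) :
  fcompat (fun n => fsub A (esub r n)).
Proof.
  generalize (esub_shift r); apply eventually_impl; intros n ->.
  rewrite fren_fsub, fsub_comp, sub_comp_ren; reflexivity.
Qed.

Lemma bcompat_sub D (r : forall t, var D t -> elem t) s (A : fm (s :: D)) :
  bcompat (fun n => fsub A (sub_up (esub r n))).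
Proof.
  generalize (esub_shift r); apply eventually_impl; intros n ->.
  rewrite fren_fsub, fsub_comp, sub_up_ren, sub_up_comp, sub_comp_ren; reflexivity.
Qed.

Definition esubst {D} (r : forall t, var D t -> elem t) {t} (u : tm D t) : elem t :=
  Elem (tcompat_sub r u).

Definition elem_cons {D s} (a : elem s) (r : forall t, var D t -> elem t) :
    forall t, var (s :: D) t -> elem t :=
  var_case (P := fun t _ => elem t) a r.

Lemma esub_cons D s (a : elem s) (r : forall t, var D t -> elem t) n :
  esub (elem_cons a r) n = sub_cons (a n) (esub r n).
Proof. apply sub_ext_cons; reflexivity. Qed.

Definition holds {D} (r : forall t, var D t -> elem t) (A : fm D) : Prop :=
  Tr (fun n => fsub A (esub r n)).

Lemma holds_all D (r : forall t, var D t -> elem t) s (A : fm (s :: D)) :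
  holds r (fAll A) <-> forall a, holds (elem_cons a r) A.
Proof.
  unfold holds; cbn [fsub]; rewrite (Tr_all (bcompat_sub r A)); split.
  - intros HI a; specialize (HI a (elem_compat a)).
    revert HI; apply eventually_impl; intros n; now rewrite inst_sub_up, esub_cons.
  - intros HI w Hw; specialize (HI (Elem Hw)).
    revert HI; apply eventually_impl; intros n; now rewrite inst_sub_up, esub_cons.
Qed.

Lemma holds_ex D (r : forall t, var D t -> elem t) s (A : fm (s :: D)) :
  holds r (fEx A) <-> exists a, holds (elem_cons a r) A.
Proof.
  unfold holds; cbn [fsub]; rewrite (Tr_ex (bcompat_sub r A)); split.
  - intros [w [Hw HI]]; exists (Elem Hw).
    revert HI; apply eventually_impl; intros n; now rewrite inst_sub_up, esub_cons.
  - intros [a HI]; exists a; split; [apply elem_compat|].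
    revert HI; apply eventually_impl; intros n; now rewrite inst_sub_up, esub_cons.
Qed.

Lemma holds_imp D (r : forall t, var D t -> elem t) A B :
  holds r (A ⟶ B) <-> (holds r A -> holds r B).
Proof. apply Tr_imp; apply fcompat_sub. Qed.

Lemma holds_and D (r : forall t, var D t -> elem t) A B :
  holds r (A ∧ B) <-> (holds r A /\ holds r B).
Proof. apply Tr_and; apply fcompat_sub. Qed.

Lemma holds_or D (r : forall t, var D t -> elem t) A B :
  holds r (A ∨ B) <-> (holds r A \/ holds r B).
Proof. apply Tr_or; apply fcompat_sub. Qed.

Lemma holds_axiom D (r : forall t, var D t -> elem t) A : T A -> holds r A.
Proof.
  intros HA; apply Tr_ded; [apply fcompat_sub|].
  apply eventually_all; intros n; apply p_ax, T_sub, HA.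
Qed.

Lemma holds_RCA D (r : forall t, var D t -> elem t) A : RCA0w A -> holds r A.
Proof. intros; now apply holds_axiom, T_RCA. Qed.

(** * Extensional equality and the quotient by it *)

Definition eqv {t} (a b : elem t) : Prop := Tr (fun n => eqt (a n) (b n)).

Lemma holds_eqt D (r : forall t, var D t -> elem t) t (a b : tm D t) :
  holds r (eqt a b) <-> eqv (esubst r a) (esubst r b).
Proof.
  unfold holds, eqv; split; apply eventually_impl; intros n;
    now rewrite fsub_eqt.
Qed.

Definition elem_nil : forall t, var [] t -> elem t :=
  fun t v => match var_nil v with end.

Lemma elem_app_compat s t (f : elem (s ⇒ t)) (a : elem s) :
  tcompat (fun n => tApp (f n) (a n)).
Proof.
  generalize (eventually_and (elem_compat f) (elem_compat a)).
  apply eventually_impl; intros n [-> ->]; reflexivity.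
Qed.

Definition elem_app {s t} (f : elem (s ⇒ t)) (a : elem s) : elem t :=
  Elem (elem_app_compat f a).

(** At an arrow type [eqt] is a universal formula, which [Tr_all] evaluates over all elements. This
    is the source of the extensionality of the quotient. *)
Lemma eqv_arr s t (f g : elem (s ⇒ t)) :
  eqv f g <-> forall a, eqv (elem_app f a) (elem_app g a).
Proof.
  assert (E : forall n a, inst (eqt (tApp (lift (f n)) (tVar V0)) (tApp (lift (g n)) (tVar V0))) a
               = eqt (tApp (f n) a) (tApp (g n) a)).
  { intros n a; unfold inst; rewrite fsub_eqt; cbn; unfold lift.
    rewrite !tren_tsub, !tsub_comp.
    change (sub_comp _ _) with (@sub_id (G n)); now rewrite !tsub_id. }
  unfold eqv at 1; cbn [eqt]; unfold all; rewrite Tr_all.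
  - split.
    + intros HI a; specialize (HI a (elem_compat a)).
      revert HI; apply eventually_impl; intros n; now rewrite E.
    + intros HI w Hw; specialize (HI (Elem Hw)).
      revert HI; apply eventually_impl; intros n; now rewrite E.
  - generalize (eventually_and (elem_compat f) (elem_compat g)).
    apply eventually_impl; intros n [-> ->]; symmetry; apply fren_eqt_app.
Qed.

Lemma eqv_refl t (a : elem t) : eqv a a.
Proof.
  induction t as [|s _ t IH]; [|now apply eqv_arr].
  pose (r := elem_cons a elem_nil).
  exact (holds_RCA r (ax_eq_refl (tVar V0))).
Qed.

Lemma eqv_sym t (a b : elem t) : eqv a b -> eqv b a.
Proof.
  induction t as [|s _ t IH]; [|rewrite !eqv_arr; auto].
  pose (r := elem_cons a (elem_cons b elem_nil)).
  pose proof (holds_RCA r (ax_eq_sym (tVar V0) (tVar (VS V0)))) as E.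
  rewrite holds_imp in E; exact E.
Qed.

Lemma eqv_trans t (a b c : elem t) : eqv a b -> eqv b c -> eqv a c.
Proof.
  induction t as [|s _ t IH].
  - pose (r := elem_cons a (elem_cons b (elem_cons c elem_nil))).
    pose proof (holds_RCA r (ax_eq_trans (tVar V0) (tVar (VS V0)) (tVar (VS (VS V0))))) as E.
    rewrite !holds_imp in E; exact E.
  - rewrite !eqv_arr; eauto.
Qed.

(** Changing the function is covered by [eqv_arr]; changing the argument is exactly the
    extensionality axiom [ax_ext]. *)
Lemma eqv_app s t (f g : elem (s ⇒ t)) a b :
  eqv f g -> eqv a b -> eqv (elem_app f a) (elem_app g b).
Proof.
  intros Hf Ha; apply eqv_trans with (elem_app f b); [|now apply eqv_arr].
  pose (r := elem_cons f (elem_cons a (elem_cons b elem_nil))).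
  pose proof (holds_RCA r (ax_ext (tVar (VS V0)) (tVar (VS (VS V0))) (tVar V0))) as E.
  rewrite holds_imp, !holds_eqt in E; exact (E Ha).
Qed.

(** The quotient is formed by choosing one representative in each class, so that equality of classes
    is identity. Equivalent elements have equal classes as predicates, and therefore get the same
    representative. *)
Definition rep {t} (a : elem t) : elem t := epsilon (inhabits a) (fun b => eqv a b).

Lemma eqv_rep t (a : elem t) : eqv a (rep a).
Proof. apply (epsilon_spec (inhabits a) (fun b => eqv a b)); exists a; apply eqv_refl. Qed.

Lemma rep_eqv t (a b : elem t) : eqv a b -> rep a = rep b.
Proof.
  intros E; unfold rep.
  replace (fun c => eqv b c) with (fun c => eqv a c).
  - now rewrite (proof_irrelevance _ (inhabits a) (inhabits b)).
  - apply functional_extensionality; intros c; apply propositional_extensionality.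
    split; intros; [apply eqv_trans with a|apply eqv_trans with b]; auto using eqv_sym.
Qed.

Definition cdom t : Type := {a : elem t | rep a = a}.

Definition cls {t} (a : elem t) : cdom t :=
  exist _ (rep a) (eq_sym (rep_eqv (eqv_rep a))).

Lemma cls_eq t (a b : elem t) : cls a = cls b <-> eqv a b.
Proof.
  split; intros E.
  - apply (f_equal (@proj1_sig _ _)) in E; cbn in E.
    apply eqv_trans with (rep a); [apply eqv_rep|].
    rewrite E; apply eqv_sym, eqv_rep.
  - unfold cls; apply eq_sig_hprop; [intros; apply proof_irrelevance|].
    now apply rep_eqv.
Qed.

Lemma cls_proj t (x : cdom t) : cls (proj1_sig x) = x.
Proof.
  destruct x as [a Ha]; apply eq_sig_hprop; [intros; apply proof_irrelevance|].
  exact Ha.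
Qed.

Definition cconst {t} (c : tm [] t) : cdom t := cls (esubst elem_nil c).

Definition henkin : model := {|
  dom := cdom;
  app s t f a := cls (elem_app (proj1_sig f) (proj1_sig a));
  mzero := cconst cZero;
  mone := cconst cOne;
  madd := cconst cAdd;
  mmul := cconst cMul;
  mpi s t := cconst (cPi s t);
  msigma r s t := cconst (cSigma r s t);
  mrec := cconst cRec;
  mlt a b := Tr (fun n => fLt (proj1_sig a n) (proj1_sig b n))
|}.

Lemma app_cls s t (f : elem (s ⇒ t)) a :
  app (m := henkin) (cls f) (cls a) = cls (elem_app f a).
Proof. apply cls_eq, eqv_app; apply eqv_sym, eqv_rep. Qed.

(** In [henkin] the order is read off the chosen representatives; [ax_lt_cong] makes it independent
    of them. *)
Lemma lt_cls (a b : elem N0) :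
  mlt (m := henkin) (cls a) (cls b) <-> Tr (fun n => fLt (a n) (b n)).
Proof.
  assert (C : forall a a' b b' : elem N0, eqv a a' -> eqv b b' ->
    Tr (fun n => fLt (a n) (b n)) -> Tr (fun n => fLt (a' n) (b' n))).
  { intros x x' y y' H1 H2.
    pose (r := elem_cons x (elem_cons x' (elem_cons y (elem_cons y' elem_nil)))).
    pose proof (holds_RCA r (ax_lt_cong (tVar V0) (tVar (VS V0))
      (tVar (VS (VS V0))) (tVar (VS (VS (VS V0)))))) as E.
    rewrite !holds_imp in E; exact (E H1 H2). }
  split; apply C; auto using eqv_rep, eqv_sym.
Qed.

Definition cenv {D} (r : forall t, var D t -> elem t) : env henkin D :=
  fun t v => cls (r t v).

Lemma ev_cls D (r : forall t, var D t -> elem t) t (u : tm D t) :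
  ev (cenv r) u = cls (esubst r u).
Proof.
  induction u; cbn [ev]; rewrite ?IHu1, ?IHu2, ?app_cls; apply cls_eq;
    match goal with |- eqv _ (esubst r ?w) => exact (eqv_refl (esubst r w)) end.
Qed.

Lemma cenv_cons D (r : forall t, var D t -> elem t) s (a : elem s) :
  env_cons (cls a : dom henkin s) (cenv r) = cenv (elem_cons a r).
Proof.
  apply functional_extensionality_dep; intros t; apply functional_extensionality.
  revert t; apply var_case; reflexivity.
Qed.

(** The truth lemma of the Henkin construction. In the quantifier cases every point of the domain is
    the class of an element, by [cls_proj]. *)
Lemma sat_cls D (A : fm D) : forall r : forall t, var D t -> elem t,
  sat A (cenv r) <-> holds r A.
Proof.
  induction A as [D|D a b|D a b|D A IHA B IHB|D A IHA B IHB|D A IHA B IHB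
                 |D s A IHA|D s A IHA]; intros r; cbn [sat].
  - split; [easy|apply Tr_bot].
  - rewrite !ev_cls, cls_eq; reflexivity.
  - rewrite !ev_cls, lt_cls; reflexivity.
  - now rewrite holds_imp, IHA, IHB.
  - now rewrite holds_and, IHA, IHB.
  - now rewrite holds_or, IHA, IHB.
  - rewrite holds_all; split; intros HI a.
    + rewrite <- IHA, <- cenv_cons; apply HI.
    + rewrite <- (cls_proj a), cenv_cons, IHA; apply HI.
  - rewrite holds_ex; split; intros [a Ha].
    + exists (proj1_sig a); rewrite <- IHA, <- cenv_cons, cls_proj; exact Ha.
    + exists (cls a); rewrite cenv_cons, IHA; exact Ha.
Qed.

Lemma cenv_proj D (e : env henkin D) : cenv (fun t v => proj1_sig (e t v)) = e.
Proof.
  apply functional_extensionality_dep; intros t; apply functional_extensionality.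
  intros v; apply cls_proj.
Qed.

Lemma henkin_extensional : extensional henkin.
Proof.
  intros s t f g E; rewrite <- (cls_proj f), <- (cls_proj g).
  apply cls_eq, eqv_arr; intros a; apply cls_eq.
  rewrite <- !app_cls, !cls_proj; apply E.
Qed.

Lemma henkin_models : models henkin T.
Proof. intros D A HA e; rewrite <- cenv_proj, sat_cls; now apply holds_axiom. Qed.

Lemma henkin_hyps A (e : env henkin []) : In A H0 -> sat A e.
Proof.
  intros HA; rewrite <- cenv_proj, sat_cls.
  apply (@Tr_from (fun n => fsub A (esub _ n)) O).
  - intros n _; rewrite fren_fsub, fsub_comp; f_equal.
    apply sub_ext; intros t v; destruct (var_nil v).
  - replace (fsub A _) with A; [exact HA|].
    rewrite <- (fsub_id A) at 1; f_equal; apply sub_ext; intros t v.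
    destruct (var_nil v).
Qed.

End Henkin.

(** If [A] were unprovable, its negation would be consistent and hold in a Henkin model, against the
    assumption on models. The theory has to contain [RCA0w] because its equality, order congruence
    and extensionality axioms make the quotient well defined. *)
Theorem completeness (T : theory) (A : fm []) :
  sub_closed T -> (forall G (B : fm G), RCA0w B -> T G B) ->
  (forall M, extensional M -> models M T -> sat (M := M) A env_nil) -> proves T A.
Proof.
  intros HT HR HM; apply p_dne, NNPP; intros C.
  pose proof (@henkin_hyps T HT HR [¬ A] C (¬ A) env_nil (or_introl eq_refl)) as HN.
  apply HN, HM; [apply henkin_extensional|apply henkin_models].
Qed.

(** * Arithmetic in extensional models *)

Notation v0 := (tVar V0).
Notation v1 := (tVar (VS V0)).
Notation v2 := (tVar (VS (VS V0))).
Notation v3 := (tVar (VS (VS (VS V0)))).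

Lemma env_ext M G (e e' : env M G) : (forall t v, e t v = e' t v) -> e = e'.
Proof.
  intros E; apply functional_extensionality_dep; intros t.
  apply functional_extensionality; apply E.
Qed.

Lemma env_cons_eta M G s (x : dom M s) (e : env M G) (f : env M (s :: G)) :
  f s V0 = x -> (forall t v, f t (VS v) = e t v) -> f = env_cons x e.
Proof.
  intros E1 E2; apply env_ext; intros t v; revert t v; apply var_case; auto.
Qed.

Lemma ev_tren M G D (r : ren G D) (e : env M D) t (u : tm G t) :
  ev e (tren r u) = ev (fun t v => e t (r t v)) u.
Proof. induction u; cbn; congruence. Qed.

Lemma ev_lift M G D (r : Ext G D) (e : env M D) t (u : tm G t) :
  ev e (lift u) = ev (fun t v => e t (ext (Ext := r) v)) u.
Proof. apply ev_tren. Qed.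

Lemma sat_fsub M G (A : fm G) : forall D (f : sub G D) (e : env M D),
  sat (fsub A f) e <-> sat A (fun t v => ev e (f t v)).
Proof.
  assert (E : forall G D (f : sub G D) (e : env M D) t (u : tm G t),
    ev e (tsub f u) = ev (fun t v => ev e (f t v)) u).
  { intros; induction u; cbn; congruence. }
  assert (C : forall G D s (f : sub G D) (e : env M D) (x : dom M s),
    (fun t v => ev (env_cons x e) (sub_up f v)) = env_cons x (fun t v => ev e (f t v))).
  { intros; apply env_ext; intros t v; revert t v; apply var_case; [reflexivity|].
    intros t v; unfold sub_up; cbn; now rewrite ev_tren. }
  induction A; intros D f e; cbn [fsub sat]; rewrite ?E; try reflexivity;
    try (rewrite IHA1, IHA2; reflexivity).
  - split; intros HA x; specialize (HA x); rewrite IHA, C in *; assumption.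
  - split; intros [x HA]; exists x; rewrite IHA, C in *; assumption.
Qed.

Section Arithmetic.

Variable M : model.
Hypothesis M_ext : extensional M.
Hypothesis M_RCA : models M RCA0w.

Lemma sat_eqt t : forall G (a b : tm G t) (e : env M G),
  sat (eqt a b) e <-> ev e a = ev e b.
Proof.
  induction t as [|s _ t IH]; intros G a b e; [reflexivity|].
  cbn [eqt]; unfold all; cbn [sat]; split.
  - intros E; apply M_ext; intros x; specialize (E x); rewrite IH in E.
    cbn in E; rewrite !ev_lift in E; exact E.
  - intros E x; rewrite IH; cbn; rewrite !ev_lift.
    exact (f_equal (fun f => app f x) E).
Qed.

Lemma app_pi s t (a : dom M s) (b : dom M t) : app (app (mpi M s t) a) b = a.
Proof.
  exact (proj1 (sat_eqt _ _ _) (M_RCA (ax_pi v0 v1)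
    (env_cons a (env_cons b env_nil)))).
Qed.

Lemma app_sigma r s t (a : dom M (r ⇒ s ⇒ t)) b c :
  app (app (app (msigma M r s t) a) b) c = app (app a c) (app b c).
Proof.
  exact (proj1 (sat_eqt _ _ _) (M_RCA (ax_sigma v0 v1 v2)
    (env_cons a (env_cons b (env_cons c env_nil))))).
Qed.

Lemma ev_abs G s t (u : tm (s :: G) t) (e : env M G) x :
  app (ev e (abs u)) x = ev (env_cons x e) u.
Proof.
  induction u; cbn [abs]; cbn; rewrite ?app_pi, ?app_sigma, ?IHu1, ?IHu2;
    try reflexivity.
  revert t v; apply var_case; cbn; intros; now rewrite ?app_sigma, ?app_pi.
Qed.

Lemma ev_lam G s t (F : tm (s :: G) s -> tm (s :: G) t) (e : env M G) x :
  app (ev e (lam s F)) x = ev (env_cons x e) (F v0).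
Proof. apply ev_abs. Qed.

Lemma ind_qf G (A : fm (N0 :: G)) (e : env M G) : qf A ->
  sat A (env_cons (mzero M) e) ->
  (forall x, sat A (env_cons x e) ->
     sat A (env_cons (app (app (madd M) x) (mone M)) e)) ->
  forall x, sat A (env_cons x e).
Proof.
  intros HA H0 HS; pose proof (M_RCA (ax_ind HA) e) as I; cbn [sat] in I.
  apply I.
  - unfold inst_zero, inst; rewrite sat_fsub.
    rewrite (@env_cons_eta M G N0 (mzero M) e); [exact H0|reflexivity..].
  - intros x Hx; unfold inst_succ; rewrite sat_fsub.
    rewrite (@env_cons_eta M G N0 (app (app (madd M) x) (mone M)) e);
      [exact (HS x Hx)|reflexivity..].
Qed.

Lemma choice_qf G (A : fm (N0 :: N1 :: G)) (e : env M G) : qf A ->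
  (forall x, exists y, sat A (env_cons y (env_cons x e))) ->
  exists Y : dom M N2, forall x, sat A (env_cons (app Y x) (env_cons x e)).
Proof.
  intros HA HE; pose proof (M_RCA (ax_choice HA) e HE) as [Y HY].
  exists Y; intros x; specialize (HY x); rewrite sat_fsub in HY.
  rewrite (@env_cons_eta M (N1 :: G) N0 (app Y x) (env_cons x e)) in HY;
    [exact HY|reflexivity|].
  intros t v; revert t v; apply var_case; reflexivity.
Qed.

(** * The ordered semiring of numbers of the model *)

Notation num := (dom M N0).
Definition add (x y : num) : num := app (app (madd M) x) y.
Definition mul (x y : num) : num := app (app (mmul M) x) y.
Definition lt (x y : num) : Prop := mlt x y.
Definition le (x y : num) : Prop := lt x y \/ x = y.
Definition pr (a b : num) : num := add (mul (add a b) (add a b)) a.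

Declare Scope num_scope.
Delimit Scope num_scope with num.
Bind Scope num_scope with dom.
Local Open Scope num_scope.
Notation "0" := (mzero M) : num_scope.
Notation "1" := (mone M) : num_scope.
Notation "x + y" := (add x y) : num_scope.
Notation "x * y" := (mul x y) : num_scope.
Notation "x < y" := (lt x y) : num_scope.
Notation "x <= y" := (le x y) : num_scope.

Let e1 (x : num) : env M [N0] := env_cons x env_nil.
Let e2 (x y : num) : env M [N0; N0] := env_cons x (e1 y).
Let e3 (x y z : num) : env M [N0; N0; N0] := env_cons x (e2 y z).

Lemma add_assoc x y z : x + (y + z) = (x + y) + z.
Proof. exact (M_RCA (ax_add_assoc v0 v1 v2) (e3 x y z)). Qed.
Lemma add_comm x y : x + y = y + x.
Proof. exact (M_RCA (ax_add_comm v0 v1) (e2 x y)). Qed.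
Lemma add_0_r x : x + 0 = x.
Proof. exact (M_RCA (ax_add_0 v0) (e1 x)). Qed.
Lemma mul_assoc x y z : x * (y * z) = (x * y) * z.
Proof. exact (M_RCA (ax_mul_assoc v0 v1 v2) (e3 x y z)). Qed.
Lemma mul_comm x y : x * y = y * x.
Proof. exact (M_RCA (ax_mul_comm v0 v1) (e2 x y)). Qed.
Lemma mul_1_r x : x * 1 = x.
Proof. exact (M_RCA (ax_mul_1 v0) (e1 x)). Qed.
Lemma mul_0_r x : x * 0 = 0.
Proof. exact (M_RCA (ax_mul_0 v0) (e1 x)). Qed.
Lemma distr_l x y z : x * (y + z) = x * y + x * z.
Proof. exact (M_RCA (ax_distr v0 v1 v2) (e3 x y z)). Qed.
Lemma lt_irrefl x : ~ x < x.
Proof. exact (M_RCA (ax_lt_irrefl v0) (e1 x)). Qed.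
Lemma lt_trans x y z : x < y -> y < z -> x < z.
Proof. exact (M_RCA (ax_lt_trans v0 v1 v2) (e3 x y z)). Qed.
Lemma lt_total x y : x < y \/ x = y \/ y < x.
Proof.
  pose proof (M_RCA (ax_lt_total v0 v1) (e2 x y)) as E; cbn in E; unfold lt; tauto.
Qed.
Lemma lt_0_1 : 0 < 1.
Proof. exact (M_RCA (ax_lt_01 _) env_nil). Qed.
Lemma lt_add_r x y z : x < y -> x + z < y + z.
Proof. exact (M_RCA (ax_lt_add v0 v1 v2) (e3 x y z)). Qed.
Lemma lt_mul_r x y z : 0 < z -> x < y -> x * z < y * z.
Proof. exact (M_RCA (ax_lt_mul v0 v1 v2) (e3 x y z)). Qed.

Lemma num_semiring : semi_ring_theory 0 1 add mul (@eq num).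
Proof.
  constructor; intros.
  - now rewrite add_comm, add_0_r.
  - apply add_comm.
  - apply add_assoc.
  - now rewrite mul_comm, mul_1_r.
  - now rewrite mul_comm, mul_0_r.
  - apply mul_comm.
  - apply mul_assoc.
  - rewrite !(mul_comm _ p); apply distr_l.
Qed.
Add Ring num_ring : num_semiring.

Lemma le_refl x : x <= x.
Proof. now right. Qed.
Lemma lt_le x y : x < y -> x <= y.
Proof. now left. Qed.
Lemma le_lt_trans x y z : x <= y -> y < z -> x < z.
Proof. intros [H| ->]; [apply lt_trans; assumption|auto]. Qed.
Lemma lt_le_trans x y z : x < y -> y <= z -> x < z.
Proof. intros H [H'|<-]; [apply lt_trans with y; assumption|auto]. Qed.
Lemma le_trans x y z : x <= y -> y <= z -> x <= z.
Proof. intros [H| ->] H'; [left; now apply lt_le_trans with y|auto]. Qed.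
Lemma le_or_lt x y : x <= y \/ y < x.
Proof. unfold le; destruct (lt_total x y) as [|[|]]; auto. Qed.
Lemma le_not_lt x y : x <= y -> ~ y < x.
Proof. intros H1 H2; apply (@lt_irrefl x); now apply le_lt_trans with y. Qed.
Lemma le_add_r x y z : x <= y -> x + z <= y + z.
Proof. intros [H| ->]; [left; now apply lt_add_r|now right]. Qed.
Lemma le_mul_r x y z : 0 <= z -> x <= y -> x * z <= y * z.
Proof.
  intros [Hz|<-] H; [|right; ring].
  destruct H as [H| ->]; [left; now apply lt_mul_r|now right].
Qed.
Lemma lt_add x y z t : x < y -> z < t -> x + z < y + t.
Proof.
  intros H1 H2; apply lt_trans with (y + z); [now apply lt_add_r|].
  rewrite !(add_comm y); now apply lt_add_r.
Qed.
Lemma lt_le_add x y z t : x < y -> z <= t -> x + z < y + t.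
Proof. intros H1 [H2| ->]; [now apply lt_add|now apply lt_add_r]. Qed.
Lemma le_add x y z t : x <= y -> z <= t -> x + z <= y + t.
Proof.
  intros [H1| ->] H2; [left; now apply lt_le_add|].
  rewrite !(add_comm y); now apply le_add_r.
Qed.
Lemma lt_add_cancel x y z : x + z < y + z -> x < y.
Proof.
  intros H; destruct (le_or_lt y x) as [H'|]; auto.
  exfalso; apply (le_not_lt (le_add_r z H') H).
Qed.
Lemma add_cancel x y z : x + z = y + z -> x = y.
Proof.
  intros E; destruct (lt_total x y) as [H|[|H]]; auto;
    apply (lt_add_r z) in H; rewrite E in H; now apply lt_irrefl in H.
Qed.
Lemma lt_mul_cancel x y z : 0 < z -> x * z < y * z -> x < y.
Proof.
  intros Hz H; destruct (le_or_lt y x) as [H'|]; auto.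
  exfalso; apply (le_not_lt (le_mul_r (lt_le Hz) H') H).
Qed.
Lemma mul_cancel x y z : 0 < z -> x * z = y * z -> x = y.
Proof.
  intros Hz E; destruct (lt_total x y) as [H|[|H]]; auto;
    apply (lt_mul_r Hz) in H; rewrite E in H; now apply lt_irrefl in H.
Qed.

Lemma num_ind G (A : fm (N0 :: G)) (e : env M G) : qf A ->
  sat A (env_cons 0 e) ->
  (forall x : num, sat A (env_cons x e) ->
     sat A (env_cons (x + 1) e)) ->
  forall x : num, sat A (env_cons x e).
Proof. exact (@ind_qf G A e). Qed.

Lemma lt_succ x : x < x + 1.
Proof.
  replace x with (0 + x) at 1 by ring; rewrite (add_comm x).
  apply lt_add_r, lt_0_1.
Qed.

Lemma le_0 x : 0 <= x.
Proof.
  apply (@num_ind [] (0 ≼ v0) env_nil); [cbn; auto|now right|].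
  intros y Hy; left; apply le_lt_trans with (y := y); [exact Hy|apply lt_succ].
Qed.

Lemma lt_0_succ x : 0 < x + 1.
Proof. apply le_lt_trans with x; [apply le_0|apply lt_succ]. Qed.

Lemma le_add_l x y : x <= x + y.
Proof.
  replace x with (0 + x) at 1 by ring; rewrite (add_comm x).
  apply le_add_r, le_0.
Qed.

Lemma rec_0 (f : dom M (N0 ⇒ N0 ⇒ N0)) (m : num) :
  app (app (app (mrec M) f) m) 0 = m.
Proof.
  exact (M_RCA (ax_rec_0 v0 v1) (env_cons f (env_cons m env_nil))).
Qed.

Lemma rec_S (f : dom M (N0 ⇒ N0 ⇒ N0)) (m n : num) :
  app (app (app (mrec M) f) m) (n + 1) = app (app f n) (app (app (app (mrec M) f) m) n).
Proof.
  exact (M_RCA (ax_rec_S v0 v1 v2)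
    (env_cons f (env_cons m (env_cons n env_nil)))).
Qed.

(** An existential statement is not open to quantifier-free induction. The predecessor [p], defined
    by recursion, names the witness and leaves a quantifier-free disjunction. *)
Lemma zero_or_succ x : x = 0 \/ exists y, x = y + 1.
Proof.
  set (p := ev (@env_nil M) (cRec · (λ j : N0, λ r : N0, ↑j) · 0)%tm).
  assert (E : x = 0 \/ x = app p x + 1); [|destruct E; eauto].
  apply (@num_ind [N1] (v0 ≐ 0 ∨ v0 ≐ v1 · v0 + 1) (env_cons p env_nil));
    [cbn; auto|now left|].
  intros y _; right.
  change (y + 1 = app p (y + 1) + 1); f_equal; unfold p; cbn [ev].
  now rewrite rec_S, !ev_lam.
Qed.

(** The witness is truncated subtraction: [s] applied to y and x iterates the predecessor x times
    from y. The second alternative of [E] records that the subtraction has been cut off at 0. *)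
Lemma le_ex x y : x <= y -> exists d, y = x + d.
Proof.
  set (p := ev (@env_nil M) (cRec · (λ j : N0, λ r : N0, ↑j) · 0)%tm).
  assert (P0 : app p 0 = 0) by (unfold p; cbn [ev]; apply rec_0).
  assert (PS : forall z, app p (z + 1) = z).
  { intros z; unfold p; cbn [ev]; now rewrite rec_S, !ev_lam. }
  set (s := ev (env_cons p env_nil)
    (cRec · (λ j : N0, λ r : N0, tVar (VS (VS V0)) · r))%tm).
  assert (S0 : app (app s y) 0 = y) by (unfold s; cbn [ev]; apply rec_0).
  assert (SS : forall z, app (app s y) (z + 1) = app p (app (app s y) z)).
  { intros z; unfold s; cbn [ev]; now rewrite rec_S, !ev_lam. }
  assert (E : x + app (app s y) x = y \/ (y < x /\ app (app s y) x = 0)).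
  { apply (@num_ind [N0; N0 ⇒ N0 ⇒ N0]
      (v0 + v2 · v1 · v0 ≐ v1 ∨ (v1 ≺ v0 ∧ v2 · v1 · v0 ≐ 0))
      (env_cons y (env_cons s env_nil))); [cbn; auto| |].
    - left; change (0 + app (app s y) 0 = y); rewrite S0; ring.
    - intros z Hz.
      change (z + 1 + app (app s y) (z + 1) = y \/
              (y < z + 1 /\ app (app s y) (z + 1) = 0)).
      change (z + app (app s y) z = y \/ (y < z /\ app (app s y) z = 0)) in Hz.
      rewrite SS; destruct Hz as [Hz|[Hz E]].
      + destruct (zero_or_succ (app (app s y) z)) as [E|[d E]]; rewrite E in *.
        * right; rewrite P0; split; auto; rewrite <- Hz, add_0_r; apply lt_succ.
        * left; rewrite PS, <- Hz; ring.
      + right; rewrite E, P0; split; auto.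
        apply lt_trans with z; auto; apply lt_succ. }
  intros H; destruct E as [E|[E _]]; [eauto|].
  exfalso; apply (le_not_lt H E).
Qed.

Lemma lt_ex x y : x < y -> exists d, y = x + 1 + d.
Proof.
  intros H; destruct (le_ex (lt_le H)) as [d ->].
  destruct (zero_or_succ d) as [->|[d' ->]].
  - rewrite add_0_r in H; now apply lt_irrefl in H.
  - exists d'; ring.
Qed.

Lemma lt_succ_le x y : x < y -> x + 1 <= y.
Proof. intros H; destruct (lt_ex H) as [d ->]; apply le_add_l. Qed.

Lemma mul_pos x y : 0 < x -> 0 < y -> 0 < x * y.
Proof.
  intros Hx Hy; replace 0 with (0 * y) by ring; now apply lt_mul_r.
Qed.

(** The code of (a, b) lies between the square of a + b and the next square, so the sum of the
    components can be read off the code. *)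
Lemma pr_lt a b c d : a + b < c + d -> pr a b < pr c d.
Proof.
  intros H; destruct (lt_ex H) as [k E]; unfold pr; rewrite E.
  apply lt_le_trans with ((a + b) * (a + b) + a + (a + b + b + 1)).
  - replace ((a + b) * (a + b) + a) with (0 + ((a + b) * (a + b) + a)) at 1 by ring.
    rewrite (add_comm _ (a + b + b + 1)); apply lt_add_r, lt_0_succ.
  - replace ((a + b + 1 + k) * (a + b + 1 + k) + c) with
      ((a + b) * (a + b) + a + (a + b + b + 1) +
       ((a + b) * k + (a + b) * k + k + k + k * k + c)) by ring.
    apply le_add_l.
Qed.

Lemma pr_inj a b c d : pr a b = pr c d -> a = c /\ b = d.
Proof.
  intros E; destruct (lt_total (a + b) (c + d)) as [H|[H|H]].
  - apply pr_lt in H; rewrite E in H; now apply lt_irrefl in H.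
  - unfold pr in E; rewrite H, !(add_comm (_ * _)) in E.
    apply add_cancel in E; subst c; split; auto.
    rewrite !(add_comm a) in H; now apply add_cancel in H.
  - apply pr_lt in H; rewrite E in H; now apply lt_irrefl in H.
Qed.

(** * Arithmetical comprehension *)

Hypothesis M_mu : sat mu2 (@env_nil M).

Lemma mu_ex : exists mu : dom M N2, forall f : dom M N1,
  (exists n, app f n = 0) -> app f (app mu f) = 0.
Proof.
  destruct M_mu as [mu H]; exists mu; intros f Hf.
  destruct (H f) as [H1 _]; exact (proj1 (H1 Hf)).
Qed.

Definition ch (P : Prop) : num := if excluded_middle_informative P then 1 else 0.

Lemma ch_true (P : Prop) : P -> ch P = 1.
Proof. unfold ch; destruct excluded_middle_informative; tauto. Qed.

Lemma ch_false (P : Prop) : ~ P -> ch P = 0.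
Proof. unfold ch; destruct excluded_middle_informative; tauto. Qed.

Lemma ch_1 (P : Prop) : ch P = 1 <-> P.
Proof.
  unfold ch; destruct excluded_middle_informative as [H|H]; split; auto; try tauto.
  intros E; exfalso; apply (@lt_irrefl 0); rewrite E at 2; apply lt_0_1.
Qed.

Lemma ch_0 (P : Prop) : ch P = 0 <-> ~ P.
Proof.
  split; [|apply ch_false]; intros E HP; apply ch_1 in HP; rewrite E in HP.
  apply (@lt_irrefl 0); rewrite HP at 2; apply lt_0_1.
Qed.

Lemma ch_ext (P Q : Prop) : (P <-> Q) -> ch P = ch Q.
Proof. unfold ch; do 2 destruct excluded_middle_informative; tauto. Qed.

Lemma ch_le_1 (P : Prop) : ch P <= 1.
Proof.
  unfold ch; destruct excluded_middle_informative; [now right|left; apply lt_0_1].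
Qed.

(** The choice axiom takes a sequence as argument, so x and y are packed into a sequence with the
    values x at 0 and y at 1. Choosing 1 where the formula holds and 0 elsewhere is again a
    quantifier-free condition. *)
Lemma binary_ch (B : fm [N0; N0]) : qf B ->
  exists c : dom M (N0 ⇒ N0 ⇒ N0), forall x y,
    app (app c x) y = ch (sat B (env_cons y (env_cons x env_nil))).
Proof.
  intros HB.
  pose (B' := fsub B (sub_cons (D := [N0; N1]) (v1 · 1)%tm
                        (sub_cons (v1 · 0)%tm (fun t v => tVar (VS (VS v)))))).
  assert (QB : qf B') by now apply qf_fsub.
  assert (EB : forall p y, sat B' (env_cons y (env_cons p env_nil)) <->
    sat B (env_cons (app p 1) (env_cons (app p 0) env_nil))).
  { intros p y; unfold B'; rewrite sat_fsub.
    match goal with |- sat _ ?e <-> sat _ ?e' => replace e with e'; [tauto|] end.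
    symmetry; apply env_cons_eta; [reflexivity|].
    intros t v; revert t v; apply var_case; [reflexivity|].
    intros t v; destruct (var_nil v). }
  destruct (@choice_qf [] ((B' ∧ v0 ≐ 1) ∨ (¬ B' ∧ v0 ≐ 0)) env_nil) as [Y HY].
  { cbn; tauto. }
  { intros p; destruct (classic (sat B (env_cons (app p 1)
      (env_cons (app p 0) env_nil)))) as [H|H].
    - exists 1; left; split; [now apply EB|reflexivity].
    - exists 0; right; split; [|reflexivity].
      intros H'; now apply EB in H'. }
  exists (ev (env_cons Y env_nil)
    (λ x : N0, λ y : N0, v2 · (cRec · (λ j : N0, λ r : N0, v2) · ↑x))%tm).
  intros x y; rewrite !ev_lam; cbn [ev].
  match goal with |- app _ ?q = _ => set (p := q) end.
  assert (P0 : app p 0 = x) by (unfold p; now rewrite rec_0).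
  assert (P1 : app p 1 = y).
  { replace (1 : num) with (0 + 1) by ring; unfold p.
    now rewrite rec_S, !ev_lam. }
  specialize (HY p); cbn [sat] in HY; rewrite EB, P0, P1 in HY.
  destruct HY as [[H1 H2]|[H1 H2]].
  - etransitivity; [exact H2|symmetry; now apply ch_true].
  - etransitivity; [exact H2|symmetry; now apply ch_false].
Qed.

(** * Functions of an environment that elements of the model represent *)

Fixpoint arrows (G : ctx) (t : ty) : ty :=
  match G with [] => t | s :: G => arrows G (s ⇒ t) end.

Fixpoint apps (G : ctx) : forall t, dom M (arrows G t) -> env M G -> dom M t :=
  match G return forall t, dom M (arrows G t) -> env M G -> dom M t with
  | [] => fun t c _ => c
  | s :: G => fun t c e => app (apps (t := s ⇒ t) c (fun r (v : var G r) => e r (VS v))) (e s V0)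
  end.

(** Characteristic functionals are obtained from elements such as μ that need not be values of
    closed terms, so abstraction is carried out in the model. The innermost variable is the last
    argument, which makes [representable_lam] immediate. *)
Definition representable G t (F : env M G -> dom M t) : Prop :=
  exists c : dom M (arrows G t), forall e, apps c e = F e.

Lemma representable_ext G t (F F' : env M G -> dom M t) :
  (forall e, F e = F' e) -> representable F -> representable F'.
Proof. intros E [c Hc]; exists c; intros e; now rewrite Hc. Qed.

Lemma representable_const G : forall t (x : dom M t), representable (fun _ : env M G => x).
Proof.
  induction G as [|s G IH]; intros t x; [now exists x|].
  destruct (IH _ (app (mpi M t s) x)) as [c Hc]; exists c; intros e; cbn.
  now rewrite Hc, app_pi.
Qed.

(** The combinator Σ hands the last argument to both functions; the remaining variables are handled
    by the induction hypothesis. *)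
Lemma representable_app G : forall s t (F : env M G -> dom M (s ⇒ t)) X,
  representable F -> representable X -> representable (fun e => app (F e) (X e)).
Proof.
  induction G as [|r G IH]; intros s t F X [c Hc] [d Hd].
  - exists (app c d); intros e; cbn; now rewrite <- Hc, <- Hd.
  - destruct (IH _ _ (fun e => app (msigma M r s t) (apps (G := G) (t := r ⇒ s ⇒ t) c e))
      (fun e => apps (G := G) (t := r ⇒ s) d e))
      as [k Hk].
    + apply IH; [apply representable_const|now exists c].
    + now exists d.
    + exists k; intros e; cbn; rewrite Hk, app_sigma, <- Hc, <- Hd; reflexivity.
Qed.

Lemma representable_ev G t (u : tm G t) : representable (fun e : env M G => ev e u).
Proof.
  induction u; cbn; try apply representable_const.
  - induction v as [G s|G s t v IH].
    + destruct (representable_const G (app (app (msigma M s (s ⇒ s) s) (mpi M s (s ⇒ s)))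
        (mpi M s s))) as [c Hc].
      exists c; intros e; cbn; now rewrite Hc, app_sigma, app_pi.
    + destruct IH as [c Hc].
      destruct (representable_app (representable_const G (mpi M t s))
        (ex_intro _ c Hc)) as [d Hd].
      exists d; intros e; cbn; now rewrite Hd, app_pi.
  - now apply representable_app.
Qed.

Lemma representable_lam G s t (F : env M (s :: G) -> dom M t) :
  representable F ->
  exists F' : env M G -> dom M (s ⇒ t), representable F' /\
    forall e x, app (F' e) x = F (env_cons x e).
Proof.
  intros [c Hc]; exists (fun e => apps (G := G) (t := s ⇒ t) c e); split.
  - now exists c.
  - intros e x; now rewrite <- Hc.
Qed.

Fixpoint arith {G} (A : fm G) : Prop :=
  match A with
  | fBot | fEq _ _ | fLt _ _ => True
  | fImp A B | fAnd A B | fOr A B => arith A /\ arith B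
  | @fAll _ s A | @fEx _ s A => s = N0 /\ arith A
  end.

Lemma representable_connective (B : fm [N0; N0]) (op : Prop -> Prop -> Prop)
    G (P Q : env M G -> Prop) : qf B ->
  (forall p q : Prop, sat B (env_cons (ch p) (env_cons (ch q) env_nil))
     <-> op p q) ->
  representable (t := N0) (fun e => ch (P e)) ->
  representable (t := N0) (fun e => ch (Q e)) ->
  representable (t := N0) (fun e => ch (op (P e) (Q e))).
Proof.
  intros HB Hop HP HQ; destruct (binary_ch HB) as [c Hc].
  apply representable_ext with (fun e => app (app c (ch (Q e))) (ch (P e))).
  - intros e; rewrite Hc; apply ch_ext, Hop.
  - apply representable_app; auto; apply representable_app; auto.
    apply representable_const.
Qed.

(** The characteristic function [F e] vanishes exactly at the counterexamples, and μ finds one if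
    there is any. Its value at the point given by μ is therefore the truth value of the universal
    statement. *)
Lemma representable_all G (P : env M (N0 :: G) -> Prop) :
  representable (t := N0) (fun e => ch (P e)) ->
  representable (t := N0) (fun e => ch (forall x, P (env_cons x e))).
Proof.
  intros HP; destruct mu_ex as [mu Hmu].
  destruct (representable_lam HP) as [F [HF EF]].
  apply representable_ext with (fun e => app (F e) (app mu (F e))).
  - intros e; destruct (classic (forall x, P (env_cons x e))) as [H|H].
    + rewrite EF; apply ch_ext; split; auto.
    + rewrite (ch_false H); apply Hmu; apply not_all_ex_not in H as [x Hx].
      exists x; rewrite EF; now apply ch_false.
  - repeat apply representable_app; auto; apply representable_const.
Qed.

Lemma representable_not G (P : env M G -> Prop) :
  representable (t := N0) (fun e => ch (P e)) ->
  representable (t := N0) (fun e => ch (~ P e)).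
Proof.
  intros HP.
  apply (@representable_connective (¬ (v0 ≐ 1)) (fun p q => ~ p) G P P);
    auto; [now cbn|].
  intros p q; cbn; pose proof (ch_1 p); pose proof (ch_1 q); tauto.
Qed.

Lemma representable_sat G (A : fm G) : arith A ->
  representable (t := N0) (fun e : env M G => ch (sat A e)).
Proof.
  induction A as [G|G a b|G a b|G A IHA B IHB|G A IHA B IHB|G A IHA B IHB
                 |G s A IHA|G s A IHA]; cbn [arith sat].
  - intros _; apply representable_const.
  - intros _; destruct (@binary_ch (v1 ≐ v0)) as [c Hc]; [exact I|].
    apply representable_ext with (fun e => app (app c (ev e a)) (ev e b)).
    + intros e; now rewrite Hc.
    + repeat apply representable_app; auto using representable_const, representable_ev.
  - intros _; destruct (@binary_ch (v1 ≺ v0)) as [c Hc]; [exact I|].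
    apply representable_ext with (fun e => app (app c (ev e a)) (ev e b)).
    + intros e; now rewrite Hc.
    + repeat apply representable_app; auto using representable_const, representable_ev.
  - intros [HA HB].
    apply (@representable_connective (v0 ≐ 1 ⟶ v1 ≐ 1) (fun p q => p -> q));
      auto; [now cbn|].
    intros p q; cbn; pose proof (ch_1 p); pose proof (ch_1 q); tauto.
  - intros [HA HB].
    apply (@representable_connective (v0 ≐ 1 ∧ v1 ≐ 1) (fun p q => p /\ q));
      auto; [now cbn|].
    intros p q; cbn; pose proof (ch_1 p); pose proof (ch_1 q); tauto.
  - intros [HA HB].
    apply (@representable_connective (v0 ≐ 1 ∨ v1 ≐ 1) (fun p q => p \/ q));
      auto; [now cbn|].
    intros p q; cbn; pose proof (ch_1 p); pose proof (ch_1 q); tauto.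
  - intros [-> HA]; now apply representable_all, IHA.
  - intros [-> HA].
    apply representable_ext with
      (fun e : env M G => ch (~ forall x, ~ sat A (env_cons x e))).
    + intros e; apply ch_ext; split; [apply not_all_not_ex|firstorder].
    + apply representable_not.
      apply (@representable_all G (fun e => ~ sat A e)).
      now apply representable_not, IHA.
Qed.

Lemma arith_comp1 G s (A : fm (s :: G)) (e : env M G) : arith A ->
  exists c : dom M (s ⇒ N0), forall x, app c x = ch (sat A (env_cons x e)).
Proof.
  intros HA; destruct (representable_sat HA) as [c Hc].
  exists (apps (G := G) (t := s ⇒ N0) c e); intros x; now rewrite <- Hc.
Qed.

Lemma arith_comp2 G s t (A : fm (t :: s :: G)) (e : env M G) : arith A ->
  exists c : dom M (s ⇒ t ⇒ N0), forall x y,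
    app (app c x) y = ch (sat A (env_cons y (env_cons x e))).
Proof.
  intros HA; destruct (representable_sat HA) as [c Hc].
  exists (apps (G := G) (t := s ⇒ t ⇒ N0) c e); intros x y; now rewrite <- Hc.
Qed.

(** Search by μ: the characteristic function of the negation vanishes exactly at the admissible
    values. *)
Lemma arith_choice G (A : fm (N0 :: N0 :: G)) (e : env M G) : arith A ->
  exists h : dom M N1, forall m, (exists v, sat A (env_cons v (env_cons m e))) ->
    sat A (env_cons (app h m) (env_cons m e)).
Proof.
  intros HA; destruct mu_ex as [mu Hmu].
  destruct (@arith_comp2 G N0 N0 (¬ A) e) as [g Hg]; [now cbn|].
  exists (ev (env_cons g (env_cons mu env_nil)) (λ m : N0, v2 · (v1 · m))%tm).
  intros m [v Hv]; rewrite ev_lam; cbn.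
  apply NNPP, ch_0; specialize (Hg m); cbn [sat] in Hg.
  etransitivity; [symmetry; apply Hg|].
  apply Hmu; exists v; rewrite Hg; apply ch_0; tauto.
Qed.

(** * Fractions *)

Record rat : Type := Rat { rpos : num; rneg : num; rden : num; rden_pos : 0 < rden }.

Definition req (p q : rat) : Prop :=
  rpos p * rden q + rneg q * rden p = rpos q * rden p + rneg p * rden q.
Definition rlt (p q : rat) : Prop :=
  rpos p * rden q + rneg q * rden p < rpos q * rden p + rneg p * rden q.
Definition rle (p q : rat) : Prop := rlt p q \/ req p q.

Definition r0 : rat := Rat 0 0 lt_0_1.
Definition r1 : rat := Rat 1 0 lt_0_1.
Definition radd (p q : rat) : rat :=
  Rat (rpos p * rden q + rpos q * rden p) (rneg p * rden q + rneg q * rden p)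
    (mul_pos (rden_pos p) (rden_pos q)).
Definition rmul (p q : rat) : rat :=
  Rat (rpos p * rpos q + rneg p * rneg q) (rpos p * rneg q + rneg p * rpos q)
    (mul_pos (rden_pos p) (rden_pos q)).
Definition ropp (p : rat) : rat := Rat (rneg p) (rpos p) (rden_pos p).
Definition rsub (p q : rat) : rat := radd p (ropp q).

Lemma req_refl p : req p p.
Proof. reflexivity. Qed.
Lemma req_sym p q : req p q -> req q p.
Proof. unfold req; intros E; symmetry; exact E. Qed.
(** Numbers have no subtraction. Both sides are multiplied by the middle denominator, and the middle
    numerators are added on both sides, before cancelling; the two lemmas on the order that follow
    proceed likewise. *)
Lemma req_trans p q r : req p q -> req q r -> req p r.
Proof.
  unfold req; destruct p as [a b d Hd], q as [a' b' d' Hd'], r as [a'' b'' d'' Hd''];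
    cbn; intros E1 E2.
  apply (mul_cancel Hd'), (@add_cancel _ _ ((a' + b') * d * d'')).
  transitivity ((a * d' + b' * d) * d'' + (a' * d'' + b'' * d') * d); [ring|].
  rewrite E1, E2; ring.
Qed.

#[local] Instance req_equiv : Equivalence req.
Proof. split; [exact req_refl|exact req_sym|exact req_trans]. Qed.

Lemma rlt_trans p q r : rlt p q -> rlt q r -> rlt p r.
Proof.
  unfold rlt; destruct p as [a b d Hd], q as [a' b' d' Hd'], r as [a'' b'' d'' Hd''];
    cbn; intros E1 E2.
  apply (lt_mul_cancel Hd'), (@lt_add_cancel _ _ ((a' + b') * d * d'')).
  replace (_ + _) with ((a * d' + b' * d) * d'' + (a' * d'' + b'' * d') * d) by ring.
  replace (_ * d' + (a' + b') * d * d'') with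
    ((a' * d + b * d') * d'' + (a'' * d' + b' * d'') * d) by ring.
  apply lt_add; now apply lt_mul_r.
Qed.

Lemma rlt_req p q r : rlt p q -> req q r -> rlt p r.
Proof.
  unfold rlt, req; destruct p as [a b d Hd], q as [a' b' d' Hd'], r as [a'' b'' d'' Hd''];
    cbn; intros E1 E2.
  apply (lt_mul_cancel Hd'), (@lt_add_cancel _ _ ((a' + b') * d * d'')).
  replace (_ + _) with ((a * d' + b' * d) * d'' + (a' * d'' + b'' * d') * d) by ring.
  replace (_ * d' + (a' + b') * d * d'') with
    ((a' * d + b * d') * d'' + (a'' * d' + b' * d'') * d) by ring.
  rewrite E2; apply lt_add_r; now apply lt_mul_r.
Qed.

Lemma req_rlt p q r : req p q -> rlt q r -> rlt p r.
Proof.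
  unfold rlt, req; destruct p as [a b d Hd], q as [a' b' d' Hd'], r as [a'' b'' d'' Hd''];
    cbn; intros E1 E2.
  apply (lt_mul_cancel Hd'), (@lt_add_cancel _ _ ((a' + b') * d * d'')).
  replace (_ + _) with ((a' * d'' + b'' * d') * d + (a * d' + b' * d) * d'') by ring.
  replace (_ * d' + (a' + b') * d * d'') with
    ((a'' * d' + b' * d'') * d + (a' * d + b * d') * d'') by ring.
  rewrite E1; apply lt_add_r; now apply lt_mul_r.
Qed.

Lemma rlt_rle_trans p q r : rlt p q -> rle q r -> rlt p r.
Proof. intros H [H'|H']; [now apply rlt_trans with q|now apply rlt_req with q]. Qed.
Lemma rlt_irrefl p : ~ rlt p p.
Proof. apply lt_irrefl. Qed.

#[local] Instance radd_proper : Proper (req ==> req ==> req) radd.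
Proof.
  intros [a b d Hd] [a' b' d' Hd'] E1 [a1 b1 d1 Hd1] [a1' b1' d1' Hd1'] E2.
  unfold req in *; cbn in *.
  transitivity ((a * d' + b' * d) * d1 * d1' + (a1 * d1' + b1' * d1) * d * d'); [ring|].
  rewrite E1, E2; ring.
Qed.

#[local] Instance ropp_proper : Proper (req ==> req) ropp.
Proof.
  intros [a b d Hd] [a' b' d' Hd'] E; unfold req in *; cbn in *.
  rewrite (add_comm (b * d')), (add_comm (b' * d)); now symmetry.
Qed.

#[local] Instance rmul_proper : Proper (req ==> req ==> req) rmul.
Proof.
  assert (C : forall p p' q, req p p' -> req (rmul p q) (rmul p' q)).
  { intros [a b d Hd] [a' b' d' Hd'] [a1 b1 d1 Hd1] E; unfold req in *; cbn in *.
    transitivity ((a * d' + b' * d) * a1 * d1 + (a' * d + b * d') * b1 * d1); [ring|].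
    transitivity ((a' * d + b * d') * a1 * d1 + (a * d' + b' * d) * b1 * d1); [|ring].
    rewrite E; reflexivity. }
  intros p p' E q q' E'; apply req_trans with (rmul p' q); [now apply C|].
  assert (S : forall x y, req (rmul x y) (rmul y x)) by (intros; unfold req; cbn; ring).
  apply req_trans with (rmul q p'); [apply S|].
  apply req_trans with (rmul q' p'); [now apply C|apply S].
Qed.

#[local] Instance rsub_proper : Proper (req ==> req ==> req) rsub.
Proof. intros p p' E q q' E'; apply radd_proper; [|apply ropp_proper]; assumption. Qed.

Lemma rat_ring : ring_theory r0 r1 radd rmul rsub ropp req.
Proof. constructor; intros; unfold req; cbn; ring. Qed.

Lemma rat_ring_ext : ring_eq_ext radd rmul ropp req.
Proof. constructor; [exact radd_proper|exact rmul_proper|exact ropp_proper]. Qed.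

Add Ring rat_ring_inst : rat_ring (setoid req_equiv rat_ring_ext).

Declare Scope rat_scope.
Delimit Scope rat_scope with rat.
Bind Scope rat_scope with rat.
Notation "p + q" := (radd p q) : rat_scope.
Notation "p - q" := (rsub p q) : rat_scope.
Notation "p < q" := (rlt p q) : rat_scope.
Notation "p <= q" := (rle p q) : rat_scope.
Notation "p == q" := (req p q) (at level 70) : rat_scope.
Local Open Scope rat_scope.

Lemma lt_eq x y x' y' : lt x y -> x = x' -> y = y' -> lt x' y'.
Proof. now intros H <- <-. Qed.

Lemma rlt_sub (p q : rat) : p < q <-> r0 < q - p.
Proof. split; intros H; apply (lt_eq H); unfold rsub; cbn; ring. Qed.

Lemma num_eq (x y x' y' : num) : x = y -> x = x' -> y = y' -> x' = y'.
Proof. now intros H <- <-. Qed.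

Lemma req_sub (p q : rat) : p == q <-> r0 == q - p.
Proof. split; intros H; apply (num_eq H); unfold rsub; cbn; ring. Qed.

(** Linear inequalities are derived by adding up hypotheses and comparing the
    difference of the two sides by [ring]. *)
Lemma rlt_of (p q r s : rat) : p < q -> q - p == s - r -> r < s.
Proof. rewrite (rlt_sub p q), (rlt_sub r s); intros H E; now apply rlt_req with (q - p). Qed.

Lemma rle_of (p q r s : rat) : p <= q -> q - p == s - r -> r <= s.
Proof.
  intros [H|H] E; [left; now apply rlt_of with p q|right].
  rewrite (req_sub p q) in H; rewrite (req_sub r s); now transitivity (q - p).
Qed.

Lemma rlt_add_r (p q r : rat) : p < q -> p + r < q + r.
Proof. intros H; apply (rlt_of H); ring. Qed.

Lemma rlt_rle_add (p q r s : rat) : p < q -> r <= s -> p + r < q + s.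
Proof.
  intros H H'; apply rlt_rle_trans with (q + r); [now apply rlt_add_r|].
  apply (rle_of H'); ring.
Qed.

Lemma rlt_add (p q r s : rat) : p < q -> r < s -> p + r < q + s.
Proof. intros H H'; apply rlt_rle_add; [|left]; assumption. Qed.

(** * Real numbers *)

Definition pw (n : num) : num := ev (env_cons n env_nil) (pow2 v0).

Arguments pw : simpl never.

Lemma pw_0 : pw 0 = 1.
Proof. apply rec_0. Qed.

Lemma pw_S n : pw (n + 1) = (pw n + pw n)%num.
Proof. unfold pw, pow2; cbn [ev]; etransitivity; [apply rec_S|]; now rewrite !ev_lam. Qed.

Lemma pw_gt n : lt n (pw n).
Proof.
  apply (@num_ind [] (v0 ≺ pow2 v0) env_nil); [now cbn|..].
  - change (lt 0 (pw 0)); rewrite pw_0; apply lt_0_1.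
  - intros x Hx; change (lt x (pw x)) in Hx; change (lt (x + 1) (pw (x + 1))).
    rewrite pw_S; apply lt_le_add; auto.
    rewrite <- (add_0_r 1), (add_comm 1); apply lt_succ_le.
    apply le_lt_trans with x; [apply le_0|exact Hx].
Qed.

Lemma pw_pos n : lt 0 (pw n).
Proof. apply le_lt_trans with n; [apply le_0|apply pw_gt]. Qed.

Lemma pw_add n i : pw (n + i) = (pw n * pw i)%num.
Proof.
  apply (@num_ind [N0] (pow2 (v1 + v0) ≐ pow2 v1 * pow2 v0) (env_cons n env_nil));
    [now cbn|..].
  - change (pw (n + 0) = (pw n * pw 0)%num); rewrite pw_0, add_0_r; ring.
  - intros x Hx; change (pw (n + x) = (pw n * pw x)%num) in Hx.
    change (pw (n + (x + 1)) = (pw n * pw (x + 1))%num).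
    rewrite pw_S, add_assoc, pw_S, Hx; ring.
Qed.

Definition hp (n : num) : rat := Rat 1 0 (pw_pos n).

Lemma hp_S n : hp (n + 1) + hp (n + 1) == hp n.
Proof. unfold req; cbn; rewrite !pw_S; ring. Qed.

(** A positive fraction with denominator c is at least 1/c, while n ≥ 4c gives 4·2^-n < 1/c because
    n < 2^n. Four terms are what [close_real_eq] consumes. *)
Lemma hp_small (d : rat) : r0 < d ->
  exists j, forall n, le j n -> hp n + hp n + (hp n + hp n) < d.
Proof.
  destruct d as [a b c Hc]; unfold rlt; cbn; intros H.
  exists (c + c + c + c)%num; intros n Hn.
  assert (H' : lt b a) by (apply (lt_eq H); ring).
  assert (L : lt (c + c + c + c)%num (pw n)).
  { apply le_lt_trans with n; [exact Hn|apply pw_gt]. }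
  destruct (lt_ex H') as [k E].
  set (w := pw n) in *; assert (Hw : lt 0 w) by apply pw_pos.
  assert (L' : lt (c + c + c + c) ((1 + k) * w)%num).
  { apply lt_le_trans with w; auto.
    replace ((1 + k) * w)%num with (w + k * w)%num by ring; apply le_add_l. }
  pose proof (lt_add_r (b * w)%num L') as L2.
  assert (Hw3 : lt 0 (w * w * w)%num) by (repeat apply mul_pos; assumption).
  apply (lt_eq (lt_mul_r Hw3 L2)); [ring|]; rewrite E; ring.
Qed.

(** * Decoding of rationals and of the formulas about reals *)

Definition isc (k : num) (p : rat) : Prop :=
  exists a b c, k = pr (pr a b) c /\ p = Rat a b (lt_0_succ c).

(** Arbitrary on numbers that code no rational, hence the conditions [coded] below. *)
Definition val (k : num) : rat := epsilon (inhabits r0) (isc k).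

Definition coded (k : num) : Prop := exists p, isc k p.

Lemma isc_val k p : isc k p -> val k = p.
Proof.
  intros H; unfold val.
  assert (H' : isc k (epsilon (inhabits r0) (isc k))).
  { apply epsilon_spec; eauto. }
  revert H'; generalize (epsilon (inhabits r0) (isc k)); intros q.
  destruct H as (a & b & c & -> & ->); intros (a' & b' & c' & E & ->).
  apply pr_inj in E as [E ->]; apply pr_inj in E as [-> ->]; reflexivity.
Qed.

Definition ev_frac G (e : env M G) (r : frac G) (R : rat) : Prop :=
  ev e (f_pos r) = rpos R /\ ev e (f_neg r) = rneg R /\ ev e (f_den r) = rden R.

Lemma ev_frac_add G (e : env M G) p q P Q :
  ev_frac e p P -> ev_frac e q Q -> ev_frac e (frac_add p q) (P + Q).
Proof.
  unfold ev_frac; intros (P1 & P2 & P3) (Q1 & Q2 & Q3); cbn.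
  rewrite P1, P2, P3, Q1, Q2, Q3; auto.
Qed.

Lemma ev_frac_lift G D (i : Ext G D) (e : env M D) (r : frac G) R :
  ev_frac (fun t v => e t (ext (Ext := i) v)) r R -> ev_frac e (frac_lift r) R.
Proof. unfold ev_frac; cbn; now rewrite !ev_lift. Qed.

(** Codes are unique by [pr_inj], so quantifying over the six components amounts to decoding both
    numbers by [val]. *)
Lemma sat_with_rats (P : forall D, frac D -> frac D -> fm D) (C : rat -> rat -> Prop)
    G (e : env M G) k l r s R S :
  (forall D (e : env M D) p q p' q', ev_frac e p p' -> ev_frac e q q' ->
     (sat (P D p q) e <-> C p' q')) ->
  ev_frac e r R -> ev_frac e s S ->
  sat (with_rats P k l r s) e <->
  (coded (ev e k) /\ coded (ev e l) /\ C (val (ev e k) + R) (val (ev e l) + S)).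
Proof.
  intros HP HR HS.
  assert (F : forall a b c a' b' c' : num,
    let e' := env_cons c' (env_cons b' (env_cons a' (env_cons c (env_cons b (env_cons a e))))) in
    sat (↑k ≐ rat_code (tVar (VS (VS (VS (VS (VS V0)))))) (tVar (VS (VS (VS (VS V0))))) v3 ∧
      ↑l ≐ rat_code v2 v1 v0 ∧
      P _ (frac_add (Frac (tVar (VS (VS (VS (VS (VS V0)))))) (tVar (VS (VS (VS (VS V0))))) (v3 + 1)) (frac_lift r))
        (frac_add (Frac v2 v1 (v0 + 1)) (frac_lift s))) e' <->
    (ev e k = pr (pr a b) c /\ ev e l = pr (pr a' b') c' /\
     C (Rat a b (lt_0_succ c) + R) (Rat a' b' (lt_0_succ c') + S))).
  { intros a b c a' b' c' e'; cbn [sat].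
    rewrite (HP _ e' _ _ (Rat a b (lt_0_succ c) + R) (Rat a' b' (lt_0_succ c') + S)).
    - cbn [ev]; rewrite !ev_lift; reflexivity.
    - apply ev_frac_add; [split; [reflexivity|split; reflexivity]|].
      apply ev_frac_lift; exact HR.
    - apply ev_frac_add; [split; [reflexivity|split; reflexivity]|].
      apply ev_frac_lift; exact HS. }
  split.
  - intros (a & b & c & a' & b' & c' & L).
    apply F in L; destruct L as (E1 & E2 & L).
    assert (I1 : isc (ev e k) (Rat a b (lt_0_succ c))) by (exists a, b, c; auto).
    assert (I2 : isc (ev e l) (Rat a' b' (lt_0_succ c'))) by (exists a', b', c'; auto).
    rewrite (isc_val I1), (isc_val I2).
    split; [eexists; exact I1|split; [eexists; exact I2|exact L]].
  - intros ((p & I1) & (q & I2) & L).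
    rewrite (isc_val I1), (isc_val I2) in L.
    destruct I1 as (a & b & c & E1 & ->), I2 as (a' & b' & c' & E2 & ->).
    exists a, b, c, a', b', c'; apply F; auto.
Qed.

Lemma sat_rat_lt G (e : env M G) k l r s R S : ev_frac e r R -> ev_frac e s S ->
  sat (rat_lt k r l s) e <->
  (coded (ev e k) /\ coded (ev e l) /\ val (ev e k) + R < val (ev e l) + S).
Proof.
  apply sat_with_rats; intros D e' p q P Q (P1 & P2 & P3) (Q1 & Q2 & Q3).
  cbn; rewrite P1, P2, P3, Q1, Q2, Q3; reflexivity.
Qed.

Lemma sat_rat_le G (e : env M G) k l r s R S : ev_frac e r R -> ev_frac e s S ->
  sat (rat_le k r l s) e <->
  (coded (ev e k) /\ coded (ev e l) /\ val (ev e k) + R <= val (ev e l) + S).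
Proof.
  apply sat_with_rats; intros D e' p q P Q (P1 & P2 & P3) (Q1 & Q2 & Q3).
  cbn; rewrite P1, P2, P3, Q1, Q2, Q3; reflexivity.
Qed.

Lemma ev_frac_zero G (e : env M G) : ev_frac e frac_zero r0.
Proof. repeat split. Qed.

Lemma ev_inv_pow2 G (e : env M G) n : ev_frac e (inv_pow2 n) (hp (ev e n)).
Proof. repeat split. Qed.

Definition hp2 (n : num) : rat := Rat (1 + 1) 0 (pw_pos n).

Lemma ev_two_inv_pow2 G (e : env M G) n : ev_frac e (two_inv_pow2 n) (hp2 (ev e n)).
Proof. repeat split. Qed.

Lemma hp2_eq n : hp2 n == hp n + hp n.
Proof. unfold req; cbn; ring. Qed.

Notation "x ! n" := (val (app x n)) (at level 9, format "x ! n") : rat_scope.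

Definition real (x : dom M N1) : Prop :=
  (forall n, coded (app x n)) /\
  forall n i, x!n < x!(add n i) + hp n /\ x!(add n i) < x!n + hp n.

Definition close (x y : dom M N1) (k n : num) : Prop :=
  x!n + hp2 n < y!n + hp k /\ y!n + hp2 n < x!n + hp k.

Lemma radd_r0_lt p q : p + r0 < q <-> p < q.
Proof. split; intros H; (eapply req_rlt; [|exact H]); ring. Qed.

Lemma sat_is_real G (e : env M G) x : sat (is_real x) e <-> real (ev e x).
Proof.
  unfold is_real, real; cbn [all sat]; split.
  - intros H; split.
    + intros n; specialize (H n 0%num); destruct H as [H _].
      rewrite (sat_rat_lt _ _ (ev_frac_zero _) (ev_inv_pow2 _ _)) in H.
      cbn [ev] in H; rewrite !ev_lift in H; apply H.
    + intros n i; specialize (H n i); destruct H as [H1 H2].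
      rewrite (sat_rat_lt _ _ (ev_frac_zero _) (ev_inv_pow2 _ _)) in H1.
      rewrite (sat_rat_lt _ _ (ev_frac_zero _) (ev_inv_pow2 _ _)) in H2.
      cbn [ev] in H1, H2; rewrite !ev_lift in H1, H2; rewrite radd_r0_lt in H1, H2.
      split; [apply H1|apply H2].
  - intros [H1 H2] n i; split;
      rewrite (sat_rat_lt _ _ (ev_frac_zero _) (ev_inv_pow2 _ _));
      cbn [ev]; rewrite !ev_lift; rewrite radd_r0_lt;
      (split; [apply H1|split; [apply H1|apply H2]]).
Qed.

Definition rleq (x y : dom M N1) : Prop :=
  forall n, coded (app x n) /\ coded (app y n) /\ x!n <= y!n + hp2 n.

Lemma sat_real_le G (e : env M G) x y :
  sat (real_le x y) e <-> rleq (ev e x) (ev e y).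
Proof.
  unfold real_le, rleq; cbn [all sat].
  assert (Z : forall p q, p + r0 <= q <-> p <= q).
  { intros p q; split; intros H; apply (rle_of H); ring. }
  split; intros H n; specialize (H n).
  - rewrite (sat_rat_le _ _ (ev_frac_zero _) (ev_two_inv_pow2 _ _)) in H.
    cbn [ev] in H; rewrite !ev_lift, Z in H; exact H.
  - rewrite (sat_rat_le _ _ (ev_frac_zero _) (ev_two_inv_pow2 _ _)).
    cbn [ev]; rewrite !ev_lift, Z; exact H.
Qed.

Lemma sat_real_close G (e : env M G) x y k :
  sat (real_close x y k) e <->
  exists n, coded (app (ev e x) n) /\ coded (app (ev e y) n) /\
    close (ev e x) (ev e y) (ev e k) n.
Proof.
  unfold real_close, close; cbn [ex sat]; split; intros [n H]; exists n.
  - destruct H as [H1 H2].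
    rewrite (sat_rat_lt _ _ (ev_two_inv_pow2 _ _) (ev_inv_pow2 _ _)) in H1.
    rewrite (sat_rat_lt _ _ (ev_two_inv_pow2 _ _) (ev_inv_pow2 _ _)) in H2.
    cbn [ev] in H1, H2; rewrite !ev_lift in H1; rewrite !ev_lift in H2.
    destruct H1 as (H1 & H3 & H4), H2 as (_ & _ & H2); auto.
  - destruct H as (H1 & H2 & H3 & H4); split;
      rewrite (sat_rat_lt _ _ (ev_two_inv_pow2 _ _) (ev_inv_pow2 _ _));
      cbn [ev]; rewrite !ev_lift; auto.
Qed.

(** After index n each of the two sequences moves by less than 2^-n, and the margin 2·2^-n built
    into closeness absorbs both moves. *)
Lemma close_tail x y k n i : real x -> real y -> close x y k n ->
  x!(add n i) < y!(add n i) + hp k /\ y!(add n i) < x!(add n i) + hp k.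
Proof.
  intros [_ Hx] [_ Hy] [H1 H2].
  destruct (Hx n i) as [X1 X2], (Hy n i) as [Y1 Y2].
  split.
  - apply (rlt_of (rlt_add X2 (rlt_add Y1 H1))).
    setoid_rewrite (hp2_eq n); ring.
  - apply (rlt_of (rlt_add Y2 (rlt_add X1 H2))).
    setoid_rewrite (hp2_eq n); ring.
Qed.

(** Needed so that a ball is a set of reals in the sense of [real_set]. The strict inequalities
    leave a positive margin, and at a late index m it exceeds 4·2^-m: half of this pays for equality
    of [x] and [x'], half for the margin required at m. *)
Lemma close_real_eq x x' y k : real x -> real x' -> real y ->
  rleq x x' -> rleq x' x -> (exists n, close x y k n) -> exists n, close x' y k n.
Proof.
  intros [_ Hx] _ [_ Hy] E1 E2 [n [H1 H2]].
  rewrite rlt_sub in H1, H2.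
  destruct (hp_small H1) as [j1 J1], (hp_small H2) as [j2 J2].
  set (m := (n + (j1 + j2))%num); exists m.
  assert (M1 : le j1 m) by (unfold m; rewrite (add_comm j1), add_assoc, add_comm; apply le_add_l).
  assert (M2 : le j2 m) by (unfold m; rewrite add_assoc, add_comm; apply le_add_l).
  specialize (J1 m M1); specialize (J2 m M2).
  destruct (Hx n (j1 + j2)%num) as [X1 X2], (Hy n (j1 + j2)%num) as [Y1 Y2].
  fold m in X1, X2, Y1, Y2.
  destruct (E1 m) as (_ & _ & E1m), (E2 m) as (_ & _ & E2m).
  split.
  - apply (rlt_of (rlt_add X2 (rlt_add Y1 (rlt_rle_add J1 E2m)))).
    setoid_rewrite (hp2_eq n); setoid_rewrite (hp2_eq m); ring.
  - apply (rlt_of (rlt_add X1 (rlt_add Y2 (rlt_rle_add J2 E1m)))).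
    setoid_rewrite (hp2_eq n); setoid_rewrite (hp2_eq m); ring.
Qed.

(** * Binary expansions *)

Definition expands (d F : dom M N1) : Prop :=
  app F 0 = 0%num /\ (forall k, app F (k + 1)%num = (app F k + app F k + app d k)%num) /\
  forall k, le (app d k) 1.

(** When [expands d F] holds, [F] at k is the integer with binary digits d(0), ..., d(k-1), so [x]
    lists the partial sums of the series of d(n)·2^-(n+1). *)
Definition represents (x F : dom M N1) : Prop :=
  forall k, isc (app x k) (Rat (app F k) 0 (pw_pos k)).

Lemma expands_lower d F n i : expands d F -> le (app F n * pw i)%num (app F (n + i)%num).
Proof.
  intros (_ & HS & _).
  apply (@num_ind [N0; N1] (v2 · v1 * pow2 v0 ≼ v2 · (v1 + v0))
    (env_cons n (env_cons F env_nil))); [now cbn|..].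
  - change (le (app F n * pw 0)%num (app F (n + 0)%num)).
    rewrite pw_0, add_0_r, mul_1_r; apply le_refl.
  - intros k Hk; change (le (app F n * pw k)%num (app F (n + k)%num)) in Hk.
    change (le (app F n * pw (k + 1))%num (app F (n + (k + 1))%num)).
    rewrite add_assoc, HS, pw_S, distr_l.
    eapply le_trans; [|apply le_add_l]; now apply le_add.
Qed.

(** The 1 added to [F] on both sides carries the induction through a digit 1, and later gives the
    strict bound required of a real. *)
Lemma expands_upper d F n i : expands d F ->
  le (app F (n + i) + 1)%num ((app F n + 1) * pw i)%num.
Proof.
  intros (_ & HS & H1).
  apply (@num_ind [N0; N1] (v2 · (v1 + v0) + 1 ≼ (v2 · v1 + 1) * pow2 v0)
    (env_cons n (env_cons F env_nil))); [now cbn|..].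
  - change (le (app F (n + 0) + 1)%num ((app F n + 1) * pw 0)%num).
    rewrite pw_0, add_0_r, mul_1_r; apply le_refl.
  - intros k Hk; change (le (app F (n + k) + 1)%num ((app F n + 1) * pw k)%num) in Hk.
    change (le (app F (n + (k + 1)) + 1)%num ((app F n + 1) * pw (k + 1))%num).
    rewrite add_assoc, HS, pw_S, distr_l.
    apply le_trans with ((app F (n + k) + 1) + (app F (n + k) + 1))%num;
      [|now apply le_add].
    replace (app F (n + k) + 1 + (app F (n + k) + 1))%num with
      (app F (n + k) + app F (n + k) + 1 + 1)%num by ring.
    apply le_add_r; rewrite !(add_comm (_ + _)%num); apply le_add_r, H1.
Qed.

Lemma represents_val x F k : represents x F -> x!k = Rat (app F k) 0 (pw_pos k).
Proof. intros H; apply isc_val, H. Qed.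

Lemma represents_coded x F k : represents x F -> coded (app x k).
Proof. intros H; eexists; apply H. Qed.

Lemma le_eq x y x' y' : le x y -> x = x' -> y = y' -> le x' y'.
Proof. now intros H <- <-. Qed.

Lemma expands_real d F x : expands d F -> represents x F -> real x.
Proof.
  intros HF Hx; split; [intros; eapply represents_coded; eauto|].
  intros n i; rewrite !(represents_val _ Hx); unfold rlt; cbn.
  pose proof (expands_lower n i HF) as L; pose proof (expands_upper n i HF) as U.
  rewrite pw_add.
  set (p := pw n) in *; set (q := pw i) in *.
  assert (Hp : lt 0 p) by apply pw_pos; assert (Hq : lt 0 q) by apply pw_pos.
  set (a := app F n) in *; set (b := app F (n + i)) in *.
  assert (Hpp : lt 0 (p * p)%num) by now apply mul_pos.
  split.
  - assert (L' : lt (a * q)%num (b + q)%num).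
    { apply le_lt_trans with b; auto; rewrite (add_comm b).
      apply (@lt_eq (0 + b)%num (q + b)%num); [now apply lt_add_r|ring|ring]. }
    apply (lt_eq (lt_mul_r Hpp L')); ring.
  - assert (L' : lt b ((a + 1) * q)%num).
    { apply lt_le_trans with (b + 1)%num; auto using lt_succ. }
    apply (lt_eq (lt_mul_r Hpp L')); ring.
Qed.

Lemma sat_in_unit_interval G (e : env M G) x d F :
  expands d F -> represents (ev e x) F -> sat (in_unit_interval x) e.
Proof.
  intros HF Hx; cbn [in_unit_interval sat]; rewrite sat_is_real, !sat_real_le.
  assert (R0 : forall n, isc (app (ev e real0) n) (Rat 0 0 (lt_0_succ 0))).
  { intros n; unfold real0; rewrite ev_lam; exists 0%num, 0%num, 0%num; split; reflexivity. }
  assert (R1 : forall n, isc (app (ev e real1) n) (Rat 1 0 (lt_0_succ 0))).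
  { intros n; unfold real1; rewrite ev_lam; exists 1%num, 0%num, 0%num; split; reflexivity. }
  split; [now apply expands_real with d F|split].
  - intros n; split; [eexists; apply R0|]; split; [eapply represents_coded; eauto|].
    rewrite (isc_val (R0 n)), (represents_val _ Hx); left.
    unfold rlt; cbn; apply (@lt_le_trans _ ((1 + 1) * pw n)%num).
    + apply (@lt_eq 0 ((1 + 1) * pw n)%num); [|ring|reflexivity].
      apply mul_pos; [apply lt_0_succ|apply pw_pos].
    + match goal with |- le _ ?y =>
        replace y with ((1 + 1) * pw n + app F n * pw n)%num by ring end.
      apply le_add_l.
  - intros n; split; [eapply represents_coded; eauto|]; split; [eexists; apply R1|].
    rewrite (isc_val (R1 n)), (represents_val _ Hx); left.
    pose proof (expands_upper 0 n HF) as U; destruct HF as (F0 & _).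
    rewrite (add_comm 0), add_0_r, F0 in U.
    assert (U' : lt (app F n) (pw n)).
    { apply lt_le_trans with (app F n + 1)%num; [apply lt_succ|].
      apply (le_eq U); ring. }
    unfold rlt; cbn.
    apply lt_le_trans with (pw n * pw n)%num.
    + apply (lt_eq (lt_mul_r (pw_pos n) U')); ring.
    + match goal with |- le _ ?y =>
        replace y with (pw n * pw n + (1 + 1) * pw n)%num by ring end.
      apply le_add_l.
Qed.

Lemma expands_mono d F d' F' : expands d F -> expands d' F' ->
  (forall k, le (app d k) (app d' k)) -> forall k, le (app F k) (app F' k).
Proof.
  intros (F0 & FS & _) (F0' & FS' & _) H k.
  apply (@num_ind [N1; N1] (v1 · v0 ≼ v2 · v0) (env_cons F (env_cons F' env_nil)));
    [now cbn|..]; clear k.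
  - change (le (app F 0) (app F' 0)); rewrite F0, F0'; apply le_refl.
  - intros k Hk; change (le (app F (k + 1)%num) (app F' (k + 1)%num)).
    rewrite FS, FS'; change (le (app F k) (app F' k)) in Hk.
    repeat apply le_add; auto.
Qed.

Lemma represents_le x F x' F' : represents x F -> represents x' F' ->
  (forall k, le (app F k) (app F' k)) -> rleq x x'.
Proof.
  intros Hx Hx' H n; split; [eapply represents_coded; eauto|].
  split; [eapply represents_coded; eauto|]; left.
  rewrite (represents_val _ Hx), (represents_val _ Hx'); unfold rlt; cbn.
  set (p := pw n); assert (Hp : lt 0 p) by apply pw_pos.
  assert (Hpp : lt 0 (p * p)%num) by now apply mul_pos.
  assert (L : lt (app F n) (app F' n + (1 + 1))%num).
  { apply le_lt_trans with (app F' n); auto.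
    rewrite add_assoc; apply lt_trans with (app F' n + 1)%num; apply lt_succ. }
  apply (lt_eq (lt_mul_r Hpp L)); ring.
Qed.

(** At index n + 1 the integers differ by at least 1, owing to digit n. Every further index doubles
    the difference, and the remaining digits do not reduce it. After division by 2^(n+1+i) this is a
    gap of 2^-(n+1). *)
Lemma expands_gap d F d' F' n : expands d F -> expands d' F' ->
  (forall k, le (app d k) (app d' k)) -> app d n = 0%num -> app d' n = 1%num ->
  forall i, le (app F (n + 1 + i) + pw i)%num (app F' (n + 1 + i)%num).
Proof.
  intros HF HF' H E E' i; pose proof (expands_mono HF HF' H) as HM.
  destruct HF as (F0 & FS & _), HF' as (F0' & FS' & _).
  apply (@num_ind [N0; N1; N1] (v2 · (v1 + 1 + v0) + pow2 v0 ≼ v3 · (v1 + 1 + v0))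
    (env_cons n (env_cons F (env_cons F' env_nil)))); [now cbn|..]; clear i.
  - change (le (app F (n + 1 + 0) + pw 0)%num (app F' (n + 1 + 0)%num)).
    rewrite pw_0, add_0_r, FS, FS', E, E', add_0_r.
    repeat apply le_add; auto using le_refl.
  - intros k Hk; change (le (app F (n + 1 + k) + pw k)%num (app F' (n + 1 + k)%num)) in Hk.
    change (le (app F (n + 1 + (k + 1)) + pw (k + 1))%num (app F' (n + 1 + (k + 1))%num)).
    rewrite add_assoc, FS, FS', pw_S.
    match goal with |- le ?u _ => replace u with
      ((app F (n + 1 + k) + pw k) + (app F (n + 1 + k) + pw k) + app d (n + 1 + k))%num
      by ring end.
    repeat apply le_add; auto.
Qed.

(** Two reals in the ball of radius [2^-(n+2)] around [y] differ by less than
    [2^-(n+1)], the value of the binary digit number [n]. *)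
Lemma close_digit y x x' d F d' F' n m m' : real y ->
  represents x F -> represents x' F' -> expands d F -> expands d' F' ->
  (forall k, le (app d k) (app d' k)) ->
  close x y (n + 1 + 1)%num m -> close x' y (n + 1 + 1)%num m' ->
  app d' n = 1%num -> app d n <> 0%num.
Proof.
  intros Hy Hx Hx' HF HF' H C C' E' E.
  assert (Rx : real x) by now apply expands_real with d F.
  assert (Rx' : real x') by now apply expands_real with d' F'.
  (* Both estimates are taken at the common index n + 1 + (m + m'), which lies beyond m and m' and
     has the form that [expands_gap] speaks of. *)
  destruct (close_tail (m' + (n + 1))%num Rx Hy C) as [_ T].
  destruct (close_tail (m + (n + 1))%num Rx' Hy C') as [T' _].
  replace (m + (m' + (n + 1)))%num with (n + 1 + (m + m'))%num in T by ring.
  replace (m' + (m + (n + 1)))%num with (n + 1 + (m + m'))%num in T' by ring.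
  pose proof (expands_gap HF HF' H E E' (m + m')%num) as Gp.
  set (i := (m + m')%num) in *; set (q := (n + 1 + i)%num) in *.
  apply (@rlt_irrefl (x'!q)), rlt_rle_trans with (x!q + hp (n + 1)).
  - apply (rlt_of (rlt_add T T')).
    setoid_rewrite <- (hp_S (n + 1)); ring.
  - rewrite (represents_val _ Hx), (represents_val _ Hx'); unfold rle, rlt, req; cbn.
    assert (L := le_mul_r (le_0 (pw (n + 1) * pw q)%num) Gp).
    assert (Eq : pw q = (pw (n + 1) * pw i)%num) by apply pw_add.
    apply (le_eq L); rewrite Eq; ring.
Qed.

(** * The net *)

Definition cons10 (f : dom M N1) (n : num) : dom M N1 :=
  ev (env_cons f (env_cons n env_nil)) (pair10 v0 v1).

(** The step function inside [pair10] is a term of the ambient context; extensionality identifies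
    its value with the one used in [cons10]. *)
Lemma ev_pair10 G (e : env M G) f n : ev e (pair10 f n) = cons10 (ev e f) (ev e n).
Proof.
  unfold cons10, pair10; cbn [ev]; f_equal; f_equal; f_equal.
  apply M_ext; intros j; apply M_ext; intros r.
  rewrite !ev_lam; cbn [ev]; rewrite !ev_lift; reflexivity.
Qed.

Lemma cons10_0 f n : app (cons10 f n) 0 = n.
Proof. apply rec_0. Qed.

Lemma cons10_S f n j : app (cons10 f n) (j + 1)%num = app f j.
Proof.
  unfold cons10, pair10; cbn [ev]; etransitivity; [apply rec_S|].
  now rewrite !ev_lam.
Qed.

(** A sequence [f] stands for the set of its rows [f_i]. *)
Definition row (f : dom M N1) (i : num) : dom M N1 :=
  ev (env_cons f (env_cons i env_nil)) (λ j : N0, v1 · pair00 v2 j)%tm.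

Lemma app_row f i j : app (row f i) j = app f (pr i j).
Proof. unfold row; now rewrite ev_lam. Qed.

Definition hits (Y : dom M N2) (f : dom M N1) (n : num) : Prop :=
  exists i, app Y (cons10 (row f i) n) = 0%num.

(** Membership in [S_f] quantifies only over row indices, so it is arithmetical in [Y]. *)
Lemma hits_ch (Y : dom M N2) : exists c : dom M (N1 ⇒ N0 ⇒ N0), forall f n,
  app (app c f) n = ch (hits Y f n).
Proof.
  destruct (@arith_comp2 [N2] N1 N0
    (∃ i : N0, v3 · pair10 (λ j : N0, v3 · pair00 v1 j) v1 ≐ 0)
    (env_cons Y env_nil)) as [c Hc]; [now cbn|].
  exists c; intros f n; rewrite Hc; apply ch_ext; unfold hits; cbn [ex sat].
  assert (E : forall i, ev (env_cons i (env_cons n (env_cons f (env_cons Y env_nil))))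
    (λ j : N0, v3 · pair00 v1 j)%tm = row f i).
  { intros i; apply M_ext; intros j; rewrite ev_lam, app_row; reflexivity. }
  split; intros [i Hi]; exists i; cbn [ev] in *;
    rewrite ev_pair10, E in *; exact Hi.
Qed.

(** Every row of [h] is f itself. Unpairing is done by arithmetical choice: the value at m is f(j)
    for the unique pair (i, j) coded by m. *)
Lemma hits_single (Y : dom M N2) (f : dom M N1) :
  exists h, forall n, app Y (cons10 f n) = 0%num -> hits Y h n.
Proof.
  destruct (@arith_choice [N1] (∃ i : N0, ∃ j : N0, v3 ≐ pair00 v1 v0 ∧ v2 ≐ tVar (VS (VS (VS (VS V0)))) · v0)
    (env_cons f env_nil)) as [h Hh]; [now cbn|].
  assert (E : row h 0 = f).
  { apply M_ext; intros j; rewrite app_row.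
    destruct (Hh (pr 0 j)) as (i & j' & E1 & E2).
    - exists (app f j), 0%num, j; split; reflexivity.
    - change (pr 0 j = pr i j') in E1; change (app h (pr 0 j) = app f j') in E2.
      apply pr_inj in E1 as [_ ->]; exact E2. }
  exists h; intros n Hn; exists 0%num; now rewrite E.
Qed.

(** The rows of [f] are placed at the indices (0, i) and those of [g] at (1, i). This gives upper
    bounds in the order by inclusion. *)
Lemma hits_union (Y : dom M N2) (f g : dom M N1) :
  exists h, forall n, hits Y f n \/ hits Y g n -> hits Y h n.
Proof.
  destruct (@arith_choice [N1; N1]
    ((∃ i : N0, ∃ j : N0, v3 ≐ pair00 (pair00 0 v1) v0 ∧
        v2 ≐ tVar (VS (VS (VS (VS V0)))) · pair00 v1 v0) ∨
     (∃ i : N0, ∃ j : N0, v3 ≐ pair00 (pair00 1 v1) v0 ∧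
        v2 ≐ tVar (VS (VS (VS (VS (VS V0))))) · pair00 v1 v0))
    (env_cons f (env_cons g env_nil))) as [h Hh]; [cbn; tauto|].
  assert (N : 0%num <> 1%num) by (intros E; apply (@lt_irrefl 0); rewrite E at 2; apply lt_0_1).
  assert (Ef : forall i, row h (pr 0 i) = row f i).
  { intros i; apply M_ext; intros j; rewrite !app_row.
    destruct (Hh (pr (pr 0 i) j)) as [(i' & j' & E1 & E2)|(i' & j' & E1 & E2)].
    - exists (app f (pr i j)); left; exists i, j; split; reflexivity.
    - change (pr (pr 0 i) j = pr (pr 0 i') j') in E1.
      change (app h (pr (pr 0 i) j) = app f (pr i' j')) in E2.
      apply pr_inj in E1 as [E1 ->]; apply pr_inj in E1 as [_ ->]; exact E2.
    - change (pr (pr 0 i) j = pr (pr 1 i') j') in E1.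
      apply pr_inj in E1 as [E1 _]; apply pr_inj in E1 as [E1 _]; now destruct N. }
  assert (Eg : forall i, row h (pr 1 i) = row g i).
  { intros i; apply M_ext; intros j; rewrite !app_row.
    destruct (Hh (pr (pr 1 i) j)) as [(i' & j' & E1 & E2)|(i' & j' & E1 & E2)].
    - exists (app g (pr i j)); right; exists i, j; split; reflexivity.
    - change (pr (pr 1 i) j = pr (pr 0 i') j') in E1.
      apply pr_inj in E1 as [E1 _]; apply pr_inj in E1 as [E1 _]; now destruct N.
    - change (pr (pr 1 i) j = pr (pr 1 i') j') in E1.
      change (app h (pr (pr 1 i) j) = app g (pr i' j')) in E2.
      apply pr_inj in E1 as [E1 ->]; apply pr_inj in E1 as [_ ->]; exact E2. }
  exists h; intros n [[i Hi]|[i Hi]].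
  - exists (pr 0 i); now rewrite Ef.
  - exists (pr 1 i); now rewrite Eg.
Qed.

Lemma rat_eq a b c c' (H : lt 0 c) (H' : lt 0 c') : c = c' -> Rat a b H = Rat a b H'.
Proof. intros <-; f_equal; apply proof_irrelevance. Qed.

Lemma binary_net (c : dom M (N1 ⇒ N0 ⇒ N0)) : (forall f n, le (app (app c f) n) 1) ->
  exists x F : dom M (N1 ⇒ N1), forall f,
    expands (app c f) (app F f) /\ represents (app x f) (app F f).
Proof.
  intros Hc.
  set (F := ev (env_cons c env_nil)
    (λ f : N1, cRec · (λ j : N0, λ r : N0, r + r + v3 · v2 · ↑j) · 0)%tm).
  (* [P] at k is 2^k - 1, because [rat_code] stores the denominator minus one. *)
  set (P := ev (@env_nil M) (cRec · (λ j : N0, λ r : N0, r + r + 1) · 0)%tm).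
  set (x := ev (env_cons P (env_cons F env_nil))
    (λ f : N1, λ k : N0, rat_code (v3 · v1 · v0) 0 (v2 · v0))%tm).
  exists x, F; intros f.
  assert (P1 : forall k, (app P k + 1)%num = pw k).
  { apply (@num_ind [N1] (v1 · v0 + 1 ≐ pow2 v0) (env_cons P env_nil)); [now cbn|..].
    - change ((app P 0 + 1)%num = pw 0); rewrite pw_0.
      replace (app P 0) with (0%num) by (symmetry; apply rec_0); ring.
    - intros k Hk; change ((app P k + 1)%num = pw k) in Hk.
      change ((app P (k + 1) + 1)%num = pw (k + 1)%num).
      rewrite pw_S, <- Hk.
      replace (app P (k + 1)%num) with (app P k + app P k + 1)%num; [ring|].
      unfold P; cbn [ev]; now rewrite rec_S, !ev_lam. }
  split; [split; [|split]|].
  - unfold F; rewrite ev_lam; apply rec_0.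
  - intros k; unfold F; rewrite ev_lam; cbn [ev]; now rewrite rec_S, !ev_lam.
  - apply Hc.
  - intros k; exists (app (app F f) k), 0%num, (app P k); split.
    + unfold x; now rewrite !ev_lam.
    + apply rat_eq; now rewrite P1.
Qed.

(** * From the limit of the net to comprehension *)

Lemma net_boot : sat Delta_CA (@env_nil M) -> sat MCT_net (@env_nil M) ->
  sat BOOT (@env_nil M).
Proof.
  intros HD HM Y.
  destruct (hits_ch Y) as [c Hc].
  destruct (@binary_net c) as (x & F & HF); [intros; rewrite Hc; apply ch_le_1|].
  assert (Hle : forall f g, (forall n, hits Y f n -> hits Y g n) ->
    forall n, le (app (app c f) n) (app (app c g) n)).
  { intros f g H n; rewrite !Hc; destruct (classic (hits Y f n)) as [H'|H'].
    - rewrite !ch_true; auto using le_refl.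
    - rewrite (ch_false H'); apply le_0. }
  pose (D := app (mpi M N0 N1) 1).
  assert (HDf : forall f, app D f = 1%num) by (intros; unfold D; apply app_pi).
  (* Inclusion of the coded sets quantifies over numbers only, so the order is given by an element
     of the model. *)
  destruct (@arith_comp2 [N1 ⇒ N0 ⇒ N0] N1 N1
    (∀ n : N0, v3 · v2 · v0 ≐ 1 ⟶ v3 · v1 · v0 ≐ 1) (env_cons c env_nil))
    as [R HR]; [now cbn|].
  assert (HR' : forall f g, app (app R f) g = 1%num <-> (forall n, hits Y f n -> hits Y g n)).
  { intros f g; rewrite HR, ch_1; cbn.
    split; intros H n; specialize (H n); rewrite !Hc, !ch_1 in *; exact H. }
  clear HR.
  destruct (HM D R x) as [y [Hy Hconv]].
  { intros f; right; apply HDf. }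
  { split; [|split; [|split]].
    - exists (app (mpi M N0 N0) 0); apply HDf.
    - intros f g h _ _ _ H1 H2; apply HR'; intros n Hn.
      apply (proj1 (HR' _ _) H2), (proj1 (HR' _ _) H1), Hn.
    - intros f _; apply HR'; auto.
    - intros f g _ _; destruct (hits_union Y f g) as [h Hh].
      exists h; split; [apply HDf|split]; apply HR'; auto. }
  { intros f _; cbn [sat]; apply sat_in_unit_interval with (app c f) (app F f); apply HF. }
  { intros f g _ _ H; apply sat_real_le, represents_le with (app F f) (app F g);
      try apply HF.
    apply expands_mono with (app c f) (app c g); try apply HF.
    apply Hle, HR', H. }
  apply sat_is_real in Hy; cbn in Hy.
  pose (ball := fun f n => exists m, close (app x f) y (n + 1 + 1)%num m).
  assert (Hball : forall f n, exists g, (forall m, hits Y f m -> hits Y g m) /\ ball g n).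
  { intros f n.
    (* Convergence is tested against the ball itself. Closeness is an existential statement about a
       number, so the ball has a characteristic functional [U], and [close_real_eq] makes [U]
       respect equality of reals. *)
    destruct (@arith_comp1 [N1; N0] N1 (real_close v0 v1 (v2 + 1 + 1))
      (env_cons y (env_cons n env_nil))) as [U HU]; [cbn; tauto|].
    assert (HS : forall z, real z ->
      (sat (real_close v0 v1 (v2 + 1 + 1)) (env_cons z (env_cons y (env_cons n env_nil)))
       <-> exists m, close z y (n + 1 + 1)%num m)).
    { intros z Hz; rewrite sat_real_close; cbn.
      split; intros [m H]; exists m; [apply H|].
      split; [apply Hz|split; [apply Hy|exact H]]. }
    assert (HU' : forall z, real z ->
      (app U z = 1%num <-> exists m, close z y (n + 1 + 1)%num m)).
    { intros z Hz; rewrite HU, ch_1; now apply HS. }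
    destruct (Hconv U) as [d [_ Hd]].
    - split.
      + intros z; cbn; rewrite HU; apply ch_le_1.
      + intros z z' Hz Hz' E.
        apply sat_is_real in Hz; apply sat_is_real in Hz'; cbn in Hz, Hz'.
        destruct E as [E1 E2]; apply sat_real_le in E1; apply sat_real_le in E2.
        cbn in E1, E2; cbn [ev env_cons]; rewrite !HU; apply ch_ext.
        rewrite !HS by assumption.
        split; apply close_real_eq; assumption.
    - exists (n + 1 + 1)%num; intros z Hz H.
      apply sat_is_real in Hz; apply sat_real_close in H; cbn in Hz, H.
      apply HU'; [exact Hz|]; destruct H as (m & _ & _ & H); now exists m.
    (* Joining f to the index d given by convergence yields an index above both, hence one whose
       value lies in the ball. *)
    - destruct (hits_union Y d f) as [g Hg]; exists g; split; [auto|].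
      apply HU'; [apply expands_real with (app c g) (app F g); apply HF|].
      apply (Hd g); [apply HDf|apply HR'; auto]. }
  assert (Hdigit : forall f g n, ball g n -> hits Y f n -> hits Y g n).
  { intros f g n [m Hm] Hf; apply NNPP; intros Hg.
    destruct (hits_union Y f g) as [h Hh].
    destruct (Hball h n) as [h' [Hh' [m' Hm']]].
    apply (close_digit (n := n) (d' := app c h') Hy (proj2 (HF g)) (proj2 (HF h'))
      (proj1 (HF g)) (proj1 (HF h')) (Hle g h' ltac:(auto)) Hm Hm').
    - rewrite Hc; apply ch_true; auto.
    - rewrite Hc; now apply ch_false. }
  (* [Z] recovers g and n from the paired sequence as its tail and its head. The formula is negated
     because [Delta_CA] tests for the value 0, the truth value of a false statement. *)
  destruct (@arith_comp1 [N1; N1 ⇒ N1; N1 ⇒ N0 ⇒ N0] N1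
    (¬ (real_close (v2 · λ j : N0, v1 · (j + 1)) v1 (v0 · 0 + 1 + 1) ⟶
        v3 · (λ j : N0, v1 · (j + 1)) · (v0 · 0) ≐ 1))
    (env_cons y (env_cons x (env_cons c env_nil)))) as [Z HZ]; [cbn; tauto|].
  assert (HZ' : forall g n, app Z (cons10 g n) = 0%num <-> (ball g n -> hits Y g n)).
  { intros g n; rewrite HZ, ch_0; cbn [sat].
    rewrite sat_real_close.
    assert (E : ev (env_cons (cons10 g n) (env_cons y (env_cons x (env_cons c env_nil))))
      (λ j : N0, v1 · (j + 1))%tm = g).
    { apply M_ext; intros j; rewrite ev_lam; apply cons10_S. }
    cbn [ev] in *; rewrite E.
    cbn [env_cons].
    assert (E0 : app (cons10 g n) (mzero M) = n) by apply cons10_0.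
    rewrite E0, Hc, ch_1.
    assert (Rg : real (app x g)) by (apply expands_real with (app c g) (app F g); apply HF).
    assert (EB : (exists m, coded (app (app x g) m) /\ coded (app y m) /\
      close (app x g) y (n + 1 + 1)%num m) <-> ball g n).
    { split; intros [m H]; exists m; [apply H|].
      split; [apply Rg|split; [apply Hy|exact H]]. }
    change (app (app (madd M) (app (app (madd M) n) (mone M))) (mone M))
      with (n + 1 + 1)%num.
    change (mone M) with 1%num.
    rewrite EB; split; [|tauto].
    intros H Hb; apply NNPP; tauto. }
  destruct (HD Y Z) as [X HX]; [|exists X; exact HX].
  intros n.
  assert (EY : sat (∃ f : N1, tVar (VS (VS (VS V0))) · pair10 f v1 ≐ 0)
      (env_cons n (env_cons Z (env_cons Y env_nil))) <->
    exists f, app Y (cons10 f n) = 0%num).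
  { split; intros [f Hf]; exists f; cbn [sat ev] in *;
      rewrite ev_pair10 in *; exact Hf. }
  assert (EZ : sat (∀ g : N1, v2 · pair10 g v1 ≐ 0)
      (env_cons n (env_cons Z (env_cons Y env_nil))) <->
    forall g, ball g n -> hits Y g n).
  { split; intros H g; specialize (H g); cbn [sat ev] in *;
      rewrite ev_pair10 in *; apply HZ'; exact H. }
  split.
  - intros H; apply EZ; intros g Hg; apply (proj1 EY) in H; destruct H as [f Hf].
    destruct (hits_single Y f) as [h Hh]; apply Hdigit with h; auto.
  - intros HA; apply EY; pose proof (proj1 EZ HA) as H.
    (* The universal statement yields a hit only through some g with [x_g] in the ball; convergence
       provides one, here above the zero sequence. *)
    destruct (Hball (app (mpi M N0 N0) 0) n) as [g [_ Hg]].
    destruct (H g Hg) as [i Hi]; now exists (row g i).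
Qed.

End Arithmetic.

Lemma fren_from_nil (A : fm []) : fren A from_nil = A.
Proof.
  rewrite fren_fsub; rewrite <- (fsub_id A) at 2; f_equal.
  apply sub_ext; intros t v; destruct (var_nil v).
Qed.

Theorem theorem3p7 :
  proves (add_axiom ACA0w Delta_CA) (fImp MCT_net BOOT).
Proof.
  apply completeness.
  - apply add_axiom_sub_closed, add_axiom_sub_closed, RCA0w_sub_closed.
  - intros G B H; left; left; exact H.
  - intros M M_ext HM.
    assert (M_RCA : models M RCA0w) by (intros G B H; apply HM; left; left; exact H).
    intros HMCT; apply net_boot; auto.
    + apply HM; left; right; symmetry; apply fren_from_nil.
    + apply HM; right; symmetry; apply fren_from_nil.
Qed.
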